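(* Let $A\subset\mathbb{Z}^2$ be finite and non-empty. For any point $y\in A$, $$\mathrm{cap}(A)=\frac{4}{\pi^2}\lim_{N\to\infty}(\log N)^2\sum_{x\in A}e_{A,B_N}(x)\,P_x[H_y>T_{B_N}].$$
   Context: $P_x$ is the law of the continuous-time simple random walk $(X_t)_{t\ge0}$ on $\mathbb{Z}^2$ with exponential holding times of parameter $1$ started at $x$; $\tau_1$ is its first jump time. $H_A=\inf\{t\ge0:X_t\in A\}$, $\widetilde H_A=\inf\{t\ge\tau_1:X_t\in A\}$, $T_A=H_{\mathbb{Z}^2\setminus A}$, $H_y=H_{\{y\}}$ ($\inf\emptyset=\infty$). $B_N=\{x\in\mathbb{Z}^2:|x|\le N\}$ is the Euclidean ball of radius $N$ around $0$. For $A\subset B_N$, $e_{A,B_N}(x)=P_x[\widetilde H_A>T_{B_N}]1_A(x)$. $p_k(x)$ is the probability that the discrete-time simple random walk from $0$ is at $x$ at time $k$, and $a(x)=\lim_n\sum_{k=0}^n(p_k(0)-p_k(x))$ is the potential kernel. $\mathrm{hm}_A(x)=\lim_{|z|\to\infty}P_z[X_{\widetilde H_A}=x]$ is the harmonic measure of $A$ from infinity, and the two-dimensional capacity is $\mathrm{cap}(A)=\sum_{x\in A}a(x-z)\,\mathrm{hm}_A(x)$ for any $z\in A$ (the value does not depend on $z\in A$). *)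

(* Defs.v *)
From HB Require Import structures.
From mathcomp Require Import all_boot all_order all_algebra.
From mathcomp Require Import all_classical all_reals all_analysis.

Set Implicit Arguments.
Unset Strict Implicit.
Unset Printing Implicit Defensive.

Import Order.TTheory GRing.Theory Num.Theory.
Import numFieldNormedType.Exports.

Local Open Scope classical_set_scope.
Local Open Scope ring_scope.

Notation Z2 := (int * int)%type.

Definition steps : seq Z2 := [:: (1, 0); (-1, 0); (0, 1); (0, -1)].

Section Lattice.
Context {R : realType}.

Definition enorm (x : Z2) : R := Num.sqrt (x.1%:~R ^+ 2 + x.2%:~R ^+ 2).

Definition ball2 (N : nat) : set Z2 := [set x | enorm x <= N%:R].

(* The filter of the limits |z| -> oo. *)
Definition at_infty : set_system Z2 :=
  filter_from [set: R] (fun r => [set z | r < enorm z]).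

Definition srw_kernel (x y : Z2) : R := (y - x \in steps)%:R / 4.

(* Probability that k independent uniform steps add up to x. *)
Definition srw_prob (k : nat) (x : Z2) : R :=
  #|[pred f : {ffun 'I_k -> 'I_4} |
      \sum_(i < k) nth (0 : Z2) steps (f i) == x]|%:R / 4 ^+ k.

Definition potential_kernel (x : Z2) : R :=
  limn (fun n => \sum_(k < n.+1) (srw_prob k 0 - srw_prob k x)).

End Lattice.

Section PathFunctionals.
Context {R : realType}.
Implicit Types (p : R -> Z2) (A : set Z2).

(* ereal_inf set0 = +oo, which is the convention used for hitting times. *)
Definition first_jump p : \bar R :=
  ereal_inf [set t%:E | t in [set t : R | 0 <= t /\ p t <> p 0]].

Definition entrance_after (s : \bar R) A p : \bar R :=
  ereal_inf [set t%:E | t in [set t : R | (s <= t%:E)%E /\ A (p t)]].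

Definition hit A p : \bar R := entrance_after 0%E A p.

Definition hit_return A p : \bar R := entrance_after (first_jump p) A p.

Definition exit A p : \bar R := hit (~` A) p.

End PathFunctionals.

Section Walk.
Context {R : realType} {d : measure_display} {T : measurableType d}.
Variables (X : T -> R -> Z2) (P : Z2 -> probability T R).

Definition jump_time (s : nat -> T -> R) (n : nat) (w : T) : R :=
  \sum_(i < n) s i w.

(* (X, (P x)_x) is the continuous-time simple random walk: every path of X is
   a right-continuous step function, visiting the skeleton Y with holding
   times s; under P x, Y is the discrete-time simple random walk from x and
   the s i are i.i.d. exponential of parameter 1, independent of Y.  The
   conditions on paths hold for every w, as on the canonical space of
   trajectories, so that the events considered below are measurable.
   The values of X at negative times are irrelevant. *)
Definition is_ctsrw : Prop :=
  exists (Y : nat -> T -> Z2) (s : nat -> T -> R),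
    [/\ (forall n v, measurable (Y n @^-1` [set v])) /\
        (forall n, measurable_fun setT (s n)),
        forall n w, 0 < s n w,
        forall w, jump_time s n w @[n --> \oo] --> +oo,
        forall n w t, jump_time s n w <= t < jump_time s n.+1 w ->
          X w t = Y n w
      & forall x n (v : nat -> Z2) (B : nat -> set R),
          (forall i, measurable (B i)) ->
          P x [set w | forall i, (i <= n)%N -> Y i w = v i /\ B i (s i w)] =
          (((v 0%N == x)%:R * \prod_(i < n) srw_kernel (v i) (v i.+1))%:E *
           \prod_(i < n.+1) exponential_prob (1 : R) (B i))%E].

Definition prob (x : Z2) (E : set T) : R := fine (P x E).

Definition equilibrium (A : set Z2) (N : nat) (x : Z2) : R :=
  prob x [set w | (exit (ball2 (R := R) N) (X w) < hit_return A (X w))%E] *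
  \1_A x.

Definition harmonic_measure (A : set Z2) (x : Z2) : R :=
  lim (prob z [set w | (hit_return A (X w) < +oo)%E /\
                       X w (fine (hit_return A (X w))) = x]
       @[z --> at_infty (R := R)]).

(* The base point z is any element of A. *)
Definition capacity (A : set Z2) (z : Z2) : R :=
  \sum_(x \in A) potential_kernel (x - z) * harmonic_measure A x.

End Walk.

(* Main.v *)
(* Let a be the potential kernel and mu the Laplacian on A of the function
   g(w) = a(w - z) - E_w[a(X_(H_A) - z)], which vanishes on A, is harmonic off
   A and is asymptotic to a.  Comparing g with (2/pi) log N P_w[T_(B_N) < H_A]
   on B_N by the maximum principle gives log N e_(A,B_N)(x) -> (pi/2) mu(x) on
   A, and, for the one-point set {y} and the function a(. - y),
   log N P_x[T_(B_N) < H_y] -> (pi/2) a(x - y).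
   A function which is harmonic on Z^2 and equal to lam a + O(1) is constant,
   so a function harmonic off A is determined, up to a constant, by its
   Laplacian on A.  Applied to g, this makes sum_x a(. - x) mu(x) constant on A;
   applied to the hitting probability w |-> P_w[X_(H_A) = x], it gives the limit
   hm_A(x) at infinity, and pairing with mu identifies hm_A with mu.
   The inputs a(x) = (2/pi) log|x| + O(1) and a(x + v) - a(x) -> 0 come from
   the fact that x1 + x2 and x1 - x2 are independent one-dimensional walks. *)

Require Import Defs.
From mathcomp Require Import all_boot all_order all_algebra.
From mathcomp Require Import all_classical all_reals all_analysis.
From mathcomp Require Import zify ring lra.

Set Implicit Arguments.
Unset Strict Implicit.
Unset Printing Implicit Defensive.

Import Order.TTheory GRing.Theory Num.Theory.
Import numFieldNormedType.Exports.

Local Open Scope classical_set_scope.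
Local Open Scope ring_scope.

(** * Walks on Z and Z^2 *)

Section Walk1D.
Context {R : realType}.

(** The one-dimensional law is controlled through the ratio of its neighbouring values: telescoping
    these ratios gives polynomial bounds in space, and the Wallis integrals bring in [pi]. The walk
    has period 2, so this is done at even times and on sites with x1 + x2 even; facts about a pass
    to the other sites by averaging over neighbours, which all have the good parity. An O(1) error
    in the logarithm suffices for the escape probabilities, because it enters multiplied by the
    escape probability itself, which is at most of order 1 / log N. The limit defining hm_A needs
    more than boundedness: the Laplacian of a hitting probability has total mass zero, so only
    increments of a remain in its representation, and these vanish at infinity. That hm_A equals mu
    is a reciprocity statement, resting on a(-x) = a(x). On the probabilistic side, events in
    continuous time become statements about indices of the skeleton, and harmonicity comes from a
    Markov property proved on cylinders. Each of the two logarithms yields a factor pi/2, whence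
    4/pi^2. *)

Definition avg (f : Z2 -> R) (x : Z2) : R := (\sum_(e <- steps) f (x + e)) / 4.

Lemma avgE (f : Z2 -> R) (x : Z2) :
  avg f x = (f (x.1 + 1, x.2) + f (x.1 - 1, x.2) +
             f (x.1, x.2 + 1) + f (x.1, x.2 - 1)) / 4.
Proof.
have pE (a b c d : int) : (a, b) + (c, d) = (a + c, b + d) :> Z2 by [].
by case: x => x1 x2; rewrite /avg /steps !big_cons big_nil !pE /= !addr0 !addrA.
Qed.

Fixpoint walk1 (k : nat) (u : int) : R :=
  if k is k'.+1 then (walk1 k' (u - 1) + walk1 k' (u + 1)) / 2 else (u == 0)%:R.

Lemma srw_prob0 (x : Z2) : srw_prob 0 x = (x == 0)%:R :> R.
Proof.
rewrite /srw_prob expr0 divr1.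
have -> : #|[pred f : {ffun 'I_0 -> 'I_4} |
    \sum_(i < 0) nth (0 : Z2) steps (f i) == x]| = (x == 0).
  rewrite (eq_card (B := [pred _ | x == 0])).
    by case: (x == 0); rewrite ?card0 // eq_cardT // -cardT card_ffun !card_ord expn0.
  by move=> f; rewrite !inE big_ord0 eq_sym.
by [].
Qed.

(** Splits off the first step of the walk by the bijection [cons1]. Since [steps] is closed under
    negation, the sites x - e are again the neighbours of [x]. *)
Lemma srw_probS (k : nat) (x : Z2) : srw_prob k.+1 x = avg (srw_prob k) x :> R.
Proof.
pose W (n : nat) (z : Z2) (f : {ffun 'I_n -> 'I_4}) : R :=
  (\sum_(i < n) nth (0 : Z2) steps (f i) == z)%:R.
have WE n z : srw_prob n z = (\sum_f W n z f) / 4 ^+ n.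
  rewrite /srw_prob -sum1_card natr_sum big_mkcond; congr (_ / _).
  by apply: eq_bigr => f _; rewrite /W inE; case: (_ == z).
pose cons1 (p : 'I_4 * {ffun 'I_k -> 'I_4}) : {ffun 'I_k.+1 -> 'I_4} :=
  [ffun i => if unlift ord0 i is Some j then p.2 j else p.1].
pose uncons (f : {ffun 'I_k.+1 -> 'I_4}) : 'I_4 * {ffun 'I_k -> 'I_4} :=
  (f ord0, [ffun j => f (lift ord0 j)]).
have consK : cancel cons1 uncons.
  move=> [a f]; rewrite /uncons /cons1 ffunE unlift_none; congr (_, _).
  by apply/ffunP => j; rewrite !ffunE liftK.
have unconsK : cancel uncons cons1.
  move=> f; apply/ffunP => i.
  by rewrite ffunE; case: unliftP => [j ->|->] /=; rewrite ?ffunE.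
rewrite WE (reindex cons1) /=; last first.
  by exists uncons => ? _; [exact: consK|exact: unconsK].
have step (a : 'I_4) (f : {ffun 'I_k -> 'I_4}) :
    W k.+1 x (cons1 (a, f)) = W k (x - nth (0 : Z2) steps a) f.
  rewrite /W big_ord_recl ffunE unlift_none /=.
  under eq_bigr => i _ do rewrite ffunE liftK /=.
  by rewrite eq_sym addrC -subr_eq eq_sym.
rewrite -(pair_bigA _ (fun a f => W k.+1 x (cons1 (a, f)))) /=.
under eq_bigr => a _ do under eq_bigr => f _ do rewrite step.
rewrite avgE !WE !big_ord_recl big_ord0 /= exprS.
have pE (a b c d : int) : (a, b) - (c, d) = (a - c, b - d) :> Z2 by [].
have n4 : (4 ^+ k : R) != 0 by rewrite expf_neq0.
case: x {step} => x1 x2; rewrite !pE /= !subr0 !opprK.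
by field.
Qed.

Lemma walk1N (k : nat) (u : int) : walk1 k (- u) = walk1 k u.
Proof.
elim: k u => [|k IH] u /=; first by rewrite oppr_eq0.
have -> : - u - 1 = - (u + 1) by lia.
have -> : - u + 1 = - (u - 1) by lia.
by rewrite !IH addrC.
Qed.

Lemma walk1_ge0 (k : nat) (u : int) : 0 <= walk1 k u.
Proof. by elim: k u => [|k IH] u //=; rewrite divr_ge0// addr_ge0. Qed.

Lemma walk1_double_odd (k : nat) (i : int) : walk1 k.*2 (i * 2 + 1) = 0.
Proof.
elim: k i => [|k IH] i /=; first by case: eqP => //; lia.
have -> : i * 2 + 1 - 1 - 1 = (i - 1) * 2 + 1 by lia.
have -> : i * 2 + 1 - 1 + 1 = i * 2 + 1 by lia.
have -> : i * 2 + 1 + 1 - 1 = i * 2 + 1 by lia.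
have -> : i * 2 + 1 + 1 + 1 = (i + 1) * 2 + 1 by lia.
by rewrite !IH addr0 mul0r addr0 mul0r.
Qed.

Lemma walk1_doubleS_even (k : nat) (i : int) : walk1 k.*2.+1 (i * 2) = 0.
Proof.
have /= -> : i * 2 - 1 = (i - 1) * 2 + 1 by lia.
by rewrite !walk1_double_odd addr0 mul0r.
Qed.

(* This ratio of successive values of the binomial law makes its closed form
   unnecessary. *)
Lemma walk1_shift2 (k : nat) (u : int) :
  (k%:R + u%:~R + 2) * walk1 k (u + 2) = (k%:R - u%:~R) * walk1 k u.
Proof.
elim: k u => [|k IH] u /=.
  have [->|u0] := eqVneq u 0; first by rewrite mulr0; lra.
  have [u2|_] := eqVneq (u + 2) 0; last by rewrite !mulr0.
  have -> : u = - 2 by lia.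
  have -> : (-2)%:~R = -2 :> R by rewrite intrN.
  by rewrite add0r addNr mul0r mulr0.
have := IH (u + 1); have := IH (u - 1).
have -> : u - 1 + 2 = u + 1 by lia.
have -> : u + 1 + 2 = u + 2 + 1 by lia.
have -> : u + 2 - 1 = u + 1 by lia.
rewrite !intrD mulrN1z mulr1z -[k.+1%:R]natr1 => h1 h2; lra.
Qed.

(** The map (x1 + x2, x1 - x2) sends the four steps to the four pairs of signs, all equally likely,
    so averaging over [steps] factors into two one-dimensional averages. *)
Lemma srw_prob_walk1 (k : nat) (x : Z2) :
  srw_prob k x = walk1 k (x.1 + x.2) * walk1 k (x.1 - x.2) :> R.
Proof.
elim: k x => [|k IH] [x1 x2].
  rewrite srw_prob0 /= -natrM mulnb; congr (nat_of_bool _)%:R.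
  by apply/eqP/andP => [[-> ->]|[/eqP h1 /eqP h2]]; [lia|congr (_, _); lia].
rewrite srw_probS avgE !IH /=.
have -> : x1 + 1 + x2 = x1 + x2 + 1 by lia.
have -> : x1 + 1 - x2 = x1 - x2 + 1 by lia.
have -> : x1 - 1 + x2 = x1 + x2 - 1 by lia.
have -> : x1 - 1 - x2 = x1 - x2 - 1 by lia.
have -> : x1 + (x2 + 1) = x1 + x2 + 1 by lia.
have -> : x1 - (x2 + 1) = x1 - x2 - 1 by lia.
have -> : x1 + (x2 - 1) = x1 + x2 - 1 by lia.
have -> : x1 - (x2 - 1) = x1 - x2 + 1 by lia.
by field.
Qed.
End Walk1D.

(** * Return probabilities *)

Section Wallis.
Context {R : realType}.

(* The antiderivative of [cos ^+ n] that vanishes at 0. *)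
Fixpoint cos_pow_prim (n : nat) : R -> R :=
  match n with
  | 0 => id
  | 1 => sin
  | (m.+1 as k).+1 =>
      k.+1%:R^-1 *: (cos ^+ k * sin + k%:R *: cos_pow_prim m)
  end.

Lemma is_derive_cos_pow_prim (n : nat) (x : R) :
  is_derive x 1 (cos_pow_prim n) (cos x ^+ n).
Proof.
elim/ltn_ind: n => -[|[|n]] IH.
- by rewrite expr0; exact: is_derive_id.
- by rewrite expr1; exact: is_derive_sin.
have IHn := IH n (leqnSn _).
apply: is_derive_eq; rewrite /GRing.scale /=.
have s2 : sin x * sin x = 1 - cos x ^+ 2 by rewrite -expr2 sin2cos2.
have n0 : n.+2%:R != 0 :> R by rewrite pnatr_eq0.
transitivity (n.+2%:R^-1 * (cos x ^+ n.+1 * cos x -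
    (sin x * sin x) * (n.+1%:R * cos x ^+ n) + n.+1%:R * cos x ^+ n)).
  by rewrite /= exprfctE; congr (_ * _); ring.
have -> : n.+1%:R = n.+2%:R - 1 :> R by rewrite -[n.+2%:R]natr1 addrK.
by rewrite s2 !exprS; field.
Qed.

Lemma cos_pow_prim0 (n : nat) : cos_pow_prim n 0 = 0.
Proof.
elim/ltn_ind: n => -[|[|n]] IH; [by []|exact: sin0|].
transitivity (n.+2%:R^-1 * ((cos ^+ n.+1) 0 * sin 0 + n.+1%:R * cos_pow_prim n 0)).
  by [].
by rewrite sin0 IH// !mulr0 addr0 mulr0.
Qed.

(** The Wallis reduction formula: the value at pi/2 is the integral of cos^n over [0, pi/2], and the
    boundary term vanishes because cos (pi/2) = 0. *)
Lemma cos_pow_primSS_pihalf (n : nat) :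
  cos_pow_prim n.+2 (pi / 2) = n.+1%:R / n.+2%:R * cos_pow_prim n (pi / 2).
Proof.
transitivity (n.+2%:R^-1 * ((cos ^+ n.+1) (pi / 2) * sin (pi / 2) +
                            n.+1%:R * cos_pow_prim n (pi / 2))); first by [].
by rewrite exprfctE cos_pihalf expr0n mul0r add0r mulrA [_^-1 * _]mulrC.
Qed.

Lemma cos_pow_prim_pihalf_noninc (n : nat) :
  cos_pow_prim n.+1 (pi / 2) <= cos_pow_prim n (pi / 2).
Proof.
pose f : R -> R := cos_pow_prim n - cos_pow_prim n.+1.
have fd (x : R) : is_derive x 1 f (cos x ^+ n - cos x ^+ n.+1).
  by apply: is_deriveB; exact: is_derive_cos_pow_prim.
have pi0 : 0 <= pi / 2 :> R by rewrite divr_ge0 ?pi_ge0.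
have : f 0 <= f (pi / 2).
  apply: (@ger0_derive1_le_cc _ f 0 (pi / 2)) => //.
  - move=> x; rewrite in_itv /= => /andP[x0 x1].
    rewrite derive1E derive_val subr_ge0 exprS ler_piMl ?cos_le1// exprn_ge0//.
    by apply: cos_ge0_pihalf; rewrite (ltW x1) (le_trans _ (ltW x0))// oppr_le0.
  - by apply: derivable_within_continuous => x _.
  - by rewrite in_itv /= lexx.
  - by rewrite in_itv /= lexx andbT.
by rewrite /f !fctE !cos_pow_prim0 subrr subr_ge0.
Qed.

(** This is binomial(2m, m) / 4^m. *)
Definition central (m : nat) : R := walk1 m.*2 0.

Lemma central0 : central 0 = 1.
Proof. by []. Qed.

Lemma centralS (m : nat) :
  central m.+1 = central m * ((m.*2.+1)%:R / (m.*2.+2)%:R).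
Proof.
have h := @walk1_shift2 R m.*2 0.
rewrite /central doubleS /= !sub0r !add0r addNr.
have -> : -1 - 1 = - (2 : int) by lia.
rewrite subrr.
have -> : (1 + 1 : int) = 2 by lia.
rewrite add0r subr0 addr0 in h.
have m2 : m.*2.+2%:R != 0 :> R by rewrite pnatr_eq0.
rewrite -[m.*2.+2]addn2 natrD in m2 *.
rewrite walk1N -[m.*2.+1]addn1 natrD.
have -> : walk1 m.*2 2 = m.*2%:R / (m.*2%:R + 2) * walk1 m.*2 0 :> R.
  by apply: (mulfI m2); rewrite h mulrA [_ * (_ / _)]mulrC divfK.
by field.
Qed.

Lemma central_gt0 (m : nat) : 0 < central m.
Proof.
elim: m => [|m IH]; first by rewrite central0.
by rewrite centralS mulr_gt0// divr_gt0// ltr0n.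
Qed.

Lemma cos_pow_prim_even (m : nat) :
  cos_pow_prim m.*2 (pi / 2) = central m * (pi / 2).
Proof.
elim: m => [|m IH]; first by rewrite central0 mul1r.
by rewrite doubleS cos_pow_primSS_pihalf IH centralS; ring.
Qed.

Lemma cos_pow_prim_odd (m : nat) :
  cos_pow_prim m.*2.+1 (pi / 2) = (m.*2.+1%:R * central m)^-1.
Proof.
elim: m => [|m IH]; first by rewrite /= sin_pihalf central0 mulr1 invr1.
rewrite doubleS cos_pow_primSS_pihalf IH centralS.
have := central_gt0 m => /lt0r_neq0 c0.
have n1 : m.*2.+1%:R != 0 :> R by rewrite pnatr_eq0.
have n2 : m.*2.+2%:R != 0 :> R by rewrite pnatr_eq0.
have n3 : m.*2.+3%:R != 0 :> R by rewrite pnatr_eq0.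
move: (central m) c0 (m.*2.+1%:R) n1 (m.*2.+2%:R) n2 (m.*2.+3%:R) n3.
move=> a a0 b b0 c c0 e e0.
by field; rewrite a0 b0 c0 e0.
Qed.

(** For the Wallis integrals W, W(2m+1) <= W(2m) reads central(m)^2 >= 2 / (pi (2m+1)), which is
    weakened to a term of the harmonic series. *)
Lemma central_sqr_ge (m : nat) : (pi * m.+1%:R)^-1 <= central m ^+ 2.
Proof.
have := cos_pow_prim_pihalf_noninc m.*2.
rewrite cos_pow_prim_even cos_pow_prim_odd.
have c0 := central_gt0 m; have p0 := @pi_gt0 R.
have n1 : 0 < m.*2.+1%:R :> R by rewrite ltr0n.
rewrite -div1r ler_pdivrMr ?mulr_gt0// => h.
rewrite -div1r ler_pdivrMr ?mulr_gt0// ?ltr0n//.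
apply: (le_trans h).
have -> : m.*2.+1%:R = 2 * m%:R + 1 :> R by rewrite -natr1 -muln2 natrM mulrC.
rewrite -[m.+1%:R]natr1.
have : 0 <= pi * central m ^+ 2 by rewrite mulr_ge0 ?sqr_ge0 ?ltW.
rewrite expr2; nra.
Qed.

(** The neighbouring comparison W(2m) <= W(2m-1). With the lower bound it places central(m)^2
    between 1/(pi (m+1)) and 1/(pi m), the source of the factor 1/pi in front of the logarithm. *)
Lemma central_sqr_le (m : nat) : (0 < m)%N -> central m ^+ 2 <= (pi * m%:R)^-1.
Proof.
case: m => // m _.
have := cos_pow_prim_pihalf_noninc m.*2.+1.
rewrite -doubleS cos_pow_prim_even cos_pow_prim_odd.
have c0 := central_gt0 m; have c1 := central_gt0 m.+1; have p0 := @pi_gt0 R.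
have -> : m.*2.+1%:R * central m = m.*2.+2%:R * central m.+1.
  by rewrite centralS mulrCA [m.*2.+2%:R * _]mulrC divfK ?pnatr_eq0// mulrC.
have n1 : 0 < m.*2.+2%:R :> R by rewrite ltr0n.
have d0 : 0 < m.*2.+2%:R * central m.+1 by exact: mulr_gt0.
rewrite -[leRHS]div1r (ler_pdivlMr _ _ d0) => h.
have e0 : 0 < pi * m.+1%:R :> R by rewrite mulr_gt0// ltr0n.
rewrite -[leRHS]div1r (ler_pdivlMr _ _ e0).
apply: le_trans h.
rewrite -[m.*2.+2]doubleS -muln2 natrM expr2.
by lra.
Qed.

End Wallis.

(** * Spatial bounds for the law at even times *)

Section Diagonal.
Context {R : realType}.
Local Notation central := (@central R).

(* With x1 + x2 = 2 i and x1 - x2 = 2 j, the walk on Z^2 is at x at time 2 m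
   with probability [diag m i * diag m j]. *)
Definition diag (m : nat) (i : int) : R := walk1 m.*2 (i * 2).

Lemma diag_ge0 (m : nat) (i : int) : 0 <= diag m i.
Proof. exact: walk1_ge0. Qed.

Lemma diag_0 (m : nat) : diag m 0 = central m.
Proof. by rewrite /diag mul0r. Qed.

Lemma diagN (m : nat) (i : int) : diag m (- i) = diag m i.
Proof. by rewrite /diag mulNr walk1N. Qed.

Lemma diag_abs (m : nat) (i : int) : diag m `|i|%N = diag m i.
Proof. by case: (intP i) => // n; rewrite abszN /= diagN. Qed.

Lemma diag_step (m i : nat) :
  (m%:R + i%:R + 1) * diag m i.+1 = (m%:R - i%:R) * diag m i.
Proof.
have := @walk1_shift2 R m.*2 (i%:Z * 2).
have -> : i%:Z * 2 + 2 = i.+1%:Z * 2 by lia.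
rewrite -/(diag m i) -/(diag m i.+1) intrM -muln2 natrM.
have -> : (i%:Z)%:~R = i%:R :> R by [].
have -> : (2 : int)%:~R = 2 :> R by [].
lra.
Qed.

Lemma diag_decr (m i : nat) : diag m i.+1 <= diag m i.
Proof.
have := diag_step m i; have := diag_ge0 m i; have := diag_ge0 m i.+1.
have := ler0n R m; have := ler0n R i.
move: (m%:R) (i%:R) (diag m i) (diag m i.+1) => a b c e *.
have p : 0 < a + b + 1 by lra.
rewrite -(ler_pM2l p); nra.
Qed.

Lemma diag_le_central (m i : nat) : diag m i <= central m.
Proof.
elim: i => [|i IH]; first by rewrite diag_0.
exact: le_trans (diag_decr m i) IH.
Qed.

(** The left side is nonincreasing in [i]: by [diag_step] this amounts to (m-i)(m+(i+1)^2) <=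
    (m+i+1)(m+i^2), whose two sides differ by i(i+1)(2i+1). *)
Lemma diag_upper (m i : nat) :
  diag m i * (m%:R + i%:R ^+ 2) <= m%:R * central m.
Proof.
elim: i => [|i IH]; first by rewrite diag_0 expr0n addr0 mulrC.
apply: le_trans IH.
have := diag_step m i; have := diag_ge0 m i; have := diag_ge0 m i.+1.
have := ler0n R m; have := ler0n R i; rewrite -[i.+1%:R]natr1.
move: (m%:R) (i%:R) (diag m i) (diag m i.+1) => a b c e b0 a0 e0 c0 h.
have p : 0 < a + b + 1 by lra.
rewrite -(ler_pM2l p) mulrA h.
have : 0 <= (b * (b + 1)) * c by rewrite !mulr_ge0//; lra.
rewrite !expr2; nra.
Qed.

(** By [diag_step], m times the i-th decrement is at most (2i+1) diag m i, hence at most (2i+1)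
    central m; the odd numbers add up to i^2. *)
Lemma diag_lower (m i : nat) :
  m%:R * (central m - diag m i) <= i%:R ^+ 2 * central m.
Proof.
elim: i => [|i IH]; first by rewrite diag_0 subrr mulr0 expr0n mul0r.
have := diag_step m i; have := diag_ge0 m i; have := diag_decr m i.
have := diag_le_central m i.
have := ler0n R m; have := ler0n R i; rewrite -[i.+1%:R]natr1.
move: IH; move: (m%:R) (i%:R) (diag m i) (diag m i.+1) (central m).
move=> a b c e k IH b0 a0 ck ec c0 h.
have h1 : a * (c - e) <= (2 * b + 1) * c.
  have : 0 <= (b + 1) * (c - e) by rewrite mulr_ge0//; lra.
  nra.
have : 0 <= (2 * b + 1) * (k - c) by rewrite mulr_ge0//; lra.
rewrite !expr2 in IH *; nra.
Qed.

Definition sqrad (i j : int) : nat := (`|i| ^ 2 + `|j| ^ 2)%N.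

(** Multiplies two instances of [diag_upper], using (m+i^2)(m+j^2) >= m (m+i^2+j^2). A factor m is
    cancelled, so m = 0 is treated apart. *)
Lemma diagM_upper (m : nat) (i j : int) :
  diag m i * diag m j * (m%:R + (sqrad i j)%:R) <= m%:R * central m ^+ 2.
Proof.
rewrite -(diag_abs m i) -(diag_abs m j) /sqrad natrD !natrX.
have := diag_upper m `|i|; have := diag_upper m `|j|.
have := diag_ge0 m `|i|%N; have := diag_ge0 m `|j|%N.
have := @central_gt0 R m.
have := ler0n R m; have := ler0n R `|i|; have := ler0n R `|j|.
move: (m%:R) (`|i|%:R : R) (`|j|%:R : R) (diag m `|i|%N) (diag m `|j|%N) (central m).
move=> a b c e f k c0 b0 a0 k0 f0 e0 hf he.
have [az|an0] := eqVneq a 0.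
  move: he hf; rewrite az !add0r !mul0r => /(ler_wpM2l f0) + /(ler_wpM2l e0).
  lra.
have {an0}a_gt0 : 0 < a by rewrite lt_def an0.
rewrite -(ler_pM2l a_gt0).
have : (e * (a + b ^+ 2)) * (f * (a + c ^+ 2)) <= (a * k) * (a * k).
  by apply: ler_pM => //; rewrite mulr_ge0// addr_ge0// ?sqr_ge0.
have : 0 <= (e * f) * (b ^+ 2 * c ^+ 2) by rewrite !mulr_ge0// sqr_ge0.
rewrite !expr2; nra.
Qed.

(** The term p_{2m}(0) - p_{2m}(x) of the series for a(x), at x = (i+j, i-j). *)
Definition diag_deficit (i j : int) (m : nat) : R :=
  central m ^+ 2 - diag m i * diag m j.

Lemma diag_deficit_ge0 (i j : int) (m : nat) : 0 <= diag_deficit i j m.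
Proof.
rewrite subr_ge0 expr2 -(diag_abs m i) -(diag_abs m j).
by apply: ler_pM; rewrite ?diag_ge0// diag_le_central.
Qed.

(** With c = central m, f = diag m j and e = diag m i, the deficit is c(c-f) + f(c-e), and
    [diag_lower] applies to each difference. *)
Lemma diag_deficit_le (i j : int) (m : nat) :
  m%:R * diag_deficit i j m <= (sqrad i j)%:R * central m ^+ 2.
Proof.
rewrite /diag_deficit -(diag_abs m i) -(diag_abs m j) /sqrad natrD !natrX.
have := diag_lower m `|i|; have := diag_lower m `|j|.
have := diag_le_central m `|i|; have := diag_le_central m `|j|.
have := diag_ge0 m `|i|%N; have := diag_ge0 m `|j|%N.
have := @central_gt0 R m.
have := ler0n R m; have := ler0n R `|i|; have := ler0n R `|j|.
move: (m%:R) (`|i|%:R : R) (`|j|%:R : R) (diag m `|i|%N) (diag m `|j|%N) (central m).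
move=> a b c e f k c0 b0 a0 k0 f0 e0 fk ek hf he.
have h1 : k * (a * (k - f)) <= k * (c ^+ 2 * k) by rewrite ler_pM2l.
have h2 : f * (a * (k - e)) <= f * (b ^+ 2 * k) by rewrite ler_wpM2l.
have h3 : f * (b ^+ 2 * k) <= k * (b ^+ 2 * k).
  by rewrite ler_wpM2r// mulr_ge0 ?sqr_ge0 ?ltW.
rewrite !expr2 in h1 h2 h3 *; nra.
Qed.

Lemma diagM_le (m : nat) (i j : int) : (0 < sqrad i j)%N ->
  diag m i * diag m j * (m%:R + (sqrad i j)%:R) <= pi^-1.
Proof.
move=> M0; apply: le_trans (diagM_upper m i j) _.
case: m => [|m]; first by rewrite mul0r invr_ge0 pi_ge0.
have := @central_sqr_le R _ (ltn0Sn m).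
have n0 : 0 < m.+1%:R :> R by rewrite ltr0n.
rewrite -(ler_pM2l n0); move=> /le_trans; apply.
by rewrite invfM mulrCA mulfV ?mulr1// gt_eqF.
Qed.

End Diagonal.

(** * Logarithmic growth of the even-time potential *)

Section Sums.
Context {R : realType}.
Implicit Types (i j : int) (m n : nat).

Lemma pi_inv_le_half : pi^-1 <= 2^-1 :> R.
Proof. by rewrite lef_pV2 ?posrE ?pi_gt0// pi_ge2. Qed.

Lemma pi_inv_gt0 : 0 < pi^-1 :> R.
Proof. by rewrite invr_gt0 pi_gt0. Qed.

(** Telescopes 1/m^2 <= 1/(m-1) - 1/m. *)
Lemma sum_inv_sqr_tail (f : nat -> R) (K : nat) (C : R) : (0 < K)%N -> 0 <= C ->
  (forall m, (K < m)%N -> f m <= C / m%:R ^+ 2) ->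
  forall n, \sum_(m < K.+1 + n) f m <= \sum_(m < K.+1) f m + C / K%:R.
Proof.
move=> K0 C0 fC n; set S := \sum_(m < K.+1) f m.
suff : \sum_(m < K.+1 + n) f m <= S + (C / K%:R - C / (K + n)%:R).
  by move=> /le_trans; apply; rewrite lerD2l lerBlDr lerDl divr_ge0.
elim: n => [|n IH]; first by rewrite !addn0 subrr addr0.
rewrite addnS big_ord_recr /=.
have Kn0 : 0 < (K + n)%:R :> R by rewrite ltr0n addn_gt0 K0.
have step : f (K.+1 + n)%N <= C / (K + n)%:R - C / (K + n.+1)%:R.
  apply: le_trans (fC _ _) _; first by rewrite addSn ltnS leq_addr.
  rewrite addSn addnS -mulrBr ler_wpM2l// -natr1.
  move: ((K + n)%:R) Kn0 => a a0.
  have a1 : 0 < a + 1 by lra.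
  have -> : a^-1 - (a + 1)^-1 = (a * (a + 1))^-1.
    by field; rewrite !gt_eqF.
  rewrite lef_pV2 ?posrE ?exprn_gt0 ?mulr_gt0//; nra.
apply: le_trans (lerD IH step) _; lra.
Qed.

(** Each new term dominates ln (1 + 1/(n+1)) <= 1/(n+1), up to the factor 1/pi. The upper bound
    below uses ln (1 - 1/(n+2)) <= -1/(n+2) in the same way. *)
Lemma sum_central_sqr_ge (n : nat) :
  pi^-1 * ln n.+1%:R <= \sum_(m < n) central m ^+ 2 :> R.
Proof.
elim: n => [|n IH]; first by rewrite ln1 mulr0 big_ord0.
rewrite big_ord_recr /=; apply: le_trans (lerD IH (central_sqr_ge n)).
rewrite invfM -mulrDr ler_wpM2l ?(ltW pi_inv_gt0)// -lerBlDl.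
have n0 : 0 < n.+1%:R :> R by rewrite ltr0n.
have n1 : 0 < n.+2%:R :> R by rewrite ltr0n.
rewrite -ln_div ?posrE//.
have -> : n.+2%:R / n.+1%:R = 1 + n.+1%:R^-1 :> R.
  by rewrite -[n.+2%:R]natr1 mulrDl mulfV ?gt_eqF// mul1r.
by apply: le_ln1Dx; rewrite (lt_trans (ltrN10 _))// invr_gt0.
Qed.

Lemma sum_central_sqr_le (n : nat) :
  \sum_(m < n.+2) central m ^+ 2 <= 1 + pi^-1 + pi^-1 * ln n.+1%:R :> R.
Proof.
elim: n => [|n IH].
  rewrite !big_ord_recr big_ord0 /= central0 expr1n add0r ln1 mulr0 addr0 lerD2l.
  by have := @central_sqr_le R 1 isT; rewrite mulr1.
rewrite big_ord_recr /=; apply: le_trans (lerD IH (central_sqr_le _)) _ => //.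
rewrite -addrA lerD2l invfM -mulrDr ler_wpM2l ?(ltW pi_inv_gt0)// -lerBrDl.
have n0 : 0 < n.+1%:R :> R by rewrite ltr0n.
have n1 : 0 < n.+2%:R :> R by rewrite ltr0n.
rewrite -[X in _ <= X]opprK opprB -ln_div ?posrE// -lerN2 opprK.
have -> : n.+1%:R / n.+2%:R = 1 + (- n.+2%:R^-1) :> R.
  rewrite -[n.+2%:R]natr1 in n1 *.
  by move: (n.+1%:R) n1 => a a1; field; rewrite gt_eqF.
apply: le_ln1Dx; rewrite ltrN2 invf_lt1//.
by rewrite ltr1n.
Qed.

(** Up to the diffusive time M = [sqrad i j], each term at a positive time is at most 1/(pi M), and
    the term at time 0 vanishes. *)
Lemma sum_diagM_le i j : (0 < sqrad i j)%N ->
  \sum_(m < (sqrad i j).+1) diag m i * diag m j <= pi^-1 :> R.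
Proof.
set M := sqrad i j => M0.
have M0' : 0 < M%:R :> R by rewrite ltr0n.
suff H n : (n <= M)%N ->
    \sum_(m < n.+1) diag m i * diag m j <= n%:R * (pi^-1 / M%:R) :> R.
  by apply: le_trans (H _ (leqnn _)) _; rewrite mulrCA mulfV ?mulr1// gt_eqF.
elim: n => [_|n IH nM].
  rewrite big_ord_recr big_ord0 /= add0r mul0r.
  by have := @diagM_upper R 0 i j; rewrite add0r mul0r pmulr_lle0.
rewrite big_ord_recr /= -natr1 mulrDl mul1r lerD ?IH ?(ltnW nM)//.
rewrite ler_pdivlMr//; apply: le_trans (@diagM_le R n.+1 _ _ M0).
by apply: ler_wpM2l; [rewrite mulr_ge0 ?diag_ge0|rewrite lerDr].
Qed.

(** Cut at M = [sqrad i j]: before, the deficit is at most central^2; after, it is at most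
    (M/pi)/m^2, and this tail sums to at most 1/pi. *)
Lemma sum_deficit_le i j n : (0 < sqrad i j)%N ->
  \sum_(m < n) diag_deficit i j m <=
    \sum_(m < (sqrad i j).+1) central m ^+ 2 + pi^-1 :> R.
Proof.
set M := sqrad i j => M0.
have M0' : 0 < M%:R :> R by rewrite ltr0n.
have p0 := pi_inv_gt0.
apply: (@le_trans _ _ (\sum_(m < M.+1 + n) diag_deficit i j m)).
  rewrite addnC big_split_ord /= lerDl.
  by apply: sumr_ge0 => m _; exact: diag_deficit_ge0.
have tail m : (M < m)%N -> diag_deficit i j m <= (pi^-1 * M%:R) / m%:R ^+ 2 :> R.
  move=> Mm; have m0 : (0 < m)%N by apply: leq_trans Mm.
  have m0' : 0 < m%:R :> R by rewrite ltr0n.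
  rewrite ler_pdivlMr ?exprn_gt0// expr2 mulrCA.
  apply: (@le_trans _ _ (m%:R * (M%:R * central m ^+ 2))).
    by rewrite ler_wpM2l// mulrC; exact: diag_deficit_le.
  have := @central_sqr_le R _ m0.
  rewrite invfM ler_pdivlMr// => h.
  by rewrite mulrCA mulrC ler_wpM2r// mulrC.
have C0 : 0 <= pi^-1 * M%:R :> R by rewrite mulr_ge0// ltW.
apply: le_trans (sum_inv_sqr_tail M0 C0 tail n) _.
rewrite mulfK ?gt_eqF// lerD2r; apply: ler_sum => m _.
by rewrite gerBl mulr_ge0 ?diag_ge0.
Qed.

Definition diag_pot i j : R := limn (fun n => \sum_(m < n) diag_deficit i j m).

Lemma sum_deficit_nondecreasing i j :
  nondecreasing_seq (fun n => \sum_(m < n) diag_deficit i j m : R).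
Proof.
apply/nondecreasing_seqP => n; rewrite big_ord_recr /= lerDl.
exact: diag_deficit_ge0.
Qed.

Lemma diag_pot_cvg i j :
  (fun n => \sum_(m < n) diag_deficit i j m : R) @ \oo --> diag_pot i j.
Proof.
have [M0|] := posnP (sqrad i j).
  have [-> ->] : i = 0 /\ j = 0 by move: M0; rewrite /sqrad; lia.
  suff H : (fun n => \sum_(m < n) diag_deficit 0 0 m : R) = cst 0.
    by rewrite /diag_pot H lim_cst//; exact: cvg_cst.
  apply/funext => n; apply: big1 => m _.
  by rewrite /diag_deficit !diag_0 -expr2 subrr.
move=> M0; apply: nondecreasing_is_cvgn; first exact: sum_deficit_nondecreasing.
by eexists => _ [n _ <-]; exact: sum_deficit_le.
Qed.

Lemma diag_pot_ge_sum i j n : \sum_(m < n) diag_deficit i j m <= diag_pot i j.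
Proof.
apply: nondecreasing_cvgn_le; first exact: sum_deficit_nondecreasing.
exact: diag_pot_cvg.
Qed.

Lemma diag_pot_ge0 i j : 0 <= diag_pot i j.
Proof. by have := diag_pot_ge_sum i j 0; rewrite big_ord0. Qed.

(** Only times up to [sqrad i j] matter: later ones add at most 1/pi, and before that the deficit
    differs from central^2 by a total of at most 1/pi. The logarithm is that of the cut. *)
Lemma diag_pot_ln i j : (0 < sqrad i j)%N ->
  `|diag_pot i j - pi^-1 * ln (sqrad i j)%:R| <= 3.
Proof.
set M := sqrad i j => M0; rewrite ler_distl.
have M0' : 0 < M%:R :> R by rewrite ltr0n.
have p0 := pi_inv_gt0; have p1 := pi_inv_le_half.
apply/andP; split; last first.
  apply: limr_le; first exact: diag_pot_cvg.
  near=> n; apply: le_trans (sum_deficit_le _ M0) _.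
  rewrite -/M; case: M M0 {M0'} => // M' _.
  apply: le_trans (lerD (sum_central_sqr_le M') (lexx _)) _; lra.
apply: le_trans (diag_pot_ge_sum i j M.+1).
rewrite [leRHS]sumrB.
have := sum_central_sqr_ge M.+1; have := sum_diagM_le M0; rewrite -/M.
have : ln M%:R <= ln M.+2%:R :> R by rewrite ler_ln ?posrE// ler_nat; lia.
move=> /(ler_wpM2l (ltW p0)).
lra.
Unshelve. all: by end_near. Qed.

End Sums.

(** * Increments of the even-time potential *)

Section Gradient.
Context {R : realType}.
Local Notation diag := (@diag R).
Local Notation diag_pot := (@diag_pot R).

Lemma diag_potNl (i j : int) : diag_pot (- i) j = diag_pot i j.
Proof.
rewrite /diag_pot; congr (limn _); apply/funext => n.
by apply: eq_bigr => m _; rewrite /diag_deficit diagN.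
Qed.

Lemma diag_potC (i j : int) : diag_pot i j = diag_pot j i.
Proof.
rewrite /diag_pot; congr (limn _); apply/funext => n.
by apply: eq_bigr => m _; rewrite /diag_deficit mulrC.
Qed.

Lemma diag_diff_le (i : nat) (j : int) (m : nat) : (0 < sqrad i j)%N ->
  diag m j * (diag m i - diag m i.+1) <= (sqrad i j)%:R^-1.
Proof.
move=> M0; have M0' : 0 < (sqrad i j)%:R :> R by rewrite ltr0n.
rewrite -[leRHS]div1r ler_pdivlMr//; have := @diagM_le R m _ _ M0.
have p := @pi_inv_le_half R.
have := @diag_ge0 R m i; have := @diag_ge0 R m j; have := @diag_decr R m i.
have := @diag_ge0 R m i.+1; have := ler0n R m.
move: (m%:R) ((sqrad i j)%:R) M0' (diag m i) (diag m j) (diag m i.+1).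
move=> a b b0 c d e *.
have : 0 <= (c * d) * a by rewrite !mulr_ge0.
have : 0 <= (e * d) * b by rewrite !mulr_ge0// ltW.
nra.
Qed.

(** [diag_step] bounds m times the decrement by (2i+1) diag m i, and [diagM_le] bounds m diag m i
    diag m j by 1/pi <= 1/2. The resulting decay 1/m^2 is summable. *)
Lemma diag_diff_tail (i : nat) (j : int) (m : nat) : (0 < sqrad i j)%N ->
  (0 < m)%N ->
  diag m j * (diag m i - diag m i.+1) <= (2 * i%:R + 1) / 2 / m%:R ^+ 2.
Proof.
move=> M0 m0; have m0' : 0 < m%:R :> R by rewrite ltr0n.
rewrite ler_pdivlMr ?exprn_gt0//; have := @diagM_le R m _ _ M0.
have p := @pi_inv_le_half R.
have := @diag_ge0 R m i; have := @diag_ge0 R m j; have := @diag_decr R m i.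
have := @diag_step R m i.
have := ler0n R (sqrad i j); have := ler0n R i.
move: (m%:R) m0' ((sqrad i j)%:R) (i%:R : R) (diag m i) (diag m j) (diag m i.+1).
move=> a a0 b u c d e u0 b0 st ec d0 c0 h.
have h1 : a * (c - e) <= (2 * u + 1) * c.
  have : 0 <= (u + 1) * (c - e) by rewrite mulr_ge0//; lra.
  nra.
have h2 : (a * d) * (a * (c - e)) <= (a * d) * ((2 * u + 1) * c).
  by rewrite ler_wpM2l// mulr_ge0// ltW.
have h3 : a * (c * d) <= 2^-1.
  have : 0 <= c * d * b by rewrite !mulr_ge0.
  nra.
have h4 : (2 * u + 1) * (a * (c * d)) <= (2 * u + 1) * 2^-1.
  by rewrite ler_wpM2l//; lra.
rewrite expr2; nra.
Qed.

Lemma diag_pot_diff_bound (i : nat) (j : int) (r t : nat) :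
  (0 < r)%N -> (0 < t)%N -> (i <= r)%N -> (r ^ 2 <= sqrad i j)%N ->
  0 <= diag_pot i.+1 j - diag_pot i j <= t%:R / r%:R + 2 / t%:R.
Proof.
move=> r0 t0 ir rM.
have M0 : (0 < sqrad i j)%N by apply: leq_trans rM; rewrite expn_gt0 r0.
have M0' : 0 < (sqrad i j)%:R :> R by rewrite ltr0n.
have r0' : 0 < r%:R :> R by rewrite ltr0n.
have t0' : 0 < t%:R :> R by rewrite ltr0n.
pose f m := diag m j * (diag m i - diag m i.+1).
have fE n : \sum_(m < n) f m =
    \sum_(m < n) diag_deficit i.+1 j m - \sum_(m < n) diag_deficit i j m.
  by rewrite -sumrB; apply: eq_bigr => m _; rewrite /f /diag_deficit; ring.
have fcvg : (fun n => \sum_(m < n) f m) @ \oo -->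
    diag_pot i.+1 j - diag_pot i j.
  rewrite (_ : (fun n => _) = (fun n => \sum_(m < n) diag_deficit i.+1 j m
      - \sum_(m < n) diag_deficit i j m)); last exact/funext.
  by apply: cvgB; exact: diag_pot_cvg.
have f0 m : 0 <= f m by rewrite mulr_ge0 ?diag_ge0 ?subr_ge0 ?diag_decr.
have fb n : \sum_(m < n) f m <= t%:R / r%:R + 2 / t%:R.
  (* Cut at m = r t: the terms before are at most 1 / r^2, those after are
     summed against 1 / m^2. *)
  set K := (r * t)%N; have K0 : (0 < K)%N by rewrite muln_gt0 r0.
  apply: (@le_trans _ _ (\sum_(m < K.+1 + n) f m)).
    by rewrite addnC big_split_ord /= lerDl sumr_ge0.
  pose C : R := (2 * i%:R + 1) / 2.
  have C0 : 0 <= C by rewrite divr_ge0// addr_ge0// mulr_ge0.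
  have fC m : (K < m)%N -> f m <= C / m%:R ^+ 2.
    by move=> Km; apply: diag_diff_tail => //; apply: leq_trans Km.
  apply: le_trans (sum_inv_sqr_tail K0 C0 fC n) _; apply: lerD.
    (* Dropping the term at time 0 leaves exactly K = r t terms, each at most 1/r^2, hence the bound
       t/r. *)
    have f00 : f 0%N <= 0.
      have h0 : diag 0 i * diag 0 j <= 0.
        by have := @diagM_upper R 0 i j; rewrite add0r mul0r pmulr_lle0.
      rewrite /f mulrBr lerBlDr add0r mulrC (le_trans h0)//.
      by rewrite mulr_ge0// diag_ge0.
    rewrite big_ord_recl /= -[leRHS]add0r lerD//.
    apply: (@le_trans _ _ (\sum_(m < K) (sqrad i j)%:R^-1)).
      by apply: ler_sum => m _; exact: diag_diff_le.
    rewrite sumr_const card_ord -[_^-1 *+ _]mulr_natl.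
    rewrite ler_pdivrMr// mulrAC ler_pdivlMr//.
    rewrite /K -!natrM ler_nat mulnAC -[(r * r)%N]/(r ^ 2)%N mulnC.
    by rewrite leq_mul2l rM orbT.
  have rt0 : 0 < r%:R * t%:R :> R by rewrite mulr_gt0.
  rewrite /K natrM ler_pdivrMr// mulrCA mulfVK ?gt_eqF//.
  have : i%:R <= r%:R :> R by rewrite ler_nat.
  have : 1 <= r%:R :> R by rewrite ler1n.
  rewrite /C; lra.
rewrite -(cvg_lim _ fcvg)//; apply/andP; split.
  apply: limr_ge; first exact: cvgP fcvg.
  by apply: nearW => n; exact: sumr_ge0.
apply: limr_le; first exact: cvgP fcvg.
exact: nearW.
Qed.

Lemma diag_pot_diff_small (eps : R) : 0 < eps ->
  exists rho : nat, forall i j : int, (rho <= sqrad i j)%N ->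
    `|diag_pot (i + 1) j - diag_pot i j| <= eps.
Proof.
move=> e0.
(* [t] is fixed first, to make 2/t small; the radius is then taken large compared with [t]. *)
pose t := (Num.truncn (4 / eps)).+1.
have t0 : 0 < t%:R :> R by rewrite ltr0n.
have te : 2 / t%:R <= eps / 2 :> R.
  have := truncnS_gt (4 / eps); rewrite -/t ltr_pdivrMr// => h.
  rewrite ler_pdivrMr//; lra.
pose r0 := (Num.truncn (2 * t%:R / eps)).+1.
have re (r : nat) : (r0 <= r)%N -> t%:R / r%:R <= eps / 2 :> R.
  move=> r0r; have r'0 : 0 < r%:R :> R by rewrite ltr0n; apply: leq_trans r0r.
  have := truncnS_gt (2 * t%:R / eps); rewrite -/r0 ltr_pdivrMr// => h.
  have : r0%:R <= r%:R :> R by rewrite ler_nat.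
  move=> /(ler_wpM2l (ltW e0)); rewrite ler_pdivrMr//; lra.
have main (i : nat) (j : int) : (2 * r0 ^ 2 <= sqrad i j)%N ->
    `|diag_pot i.+1 j - diag_pot i j| <= eps.
  (* The larger coordinate serves as [r]: its square lies between [sqrad i j] / 2 and
     [sqrad i j]. *)
  move=> h; pose r := maxn i `|j|.
  have rM : (r ^ 2 <= sqrad i j)%N by rewrite /r /sqrad; nia.
  have rr : (r0 <= r)%N.
    by move: h; rewrite /r /sqrad; nia.
  have rpos : (0 < r)%N by apply: leq_trans rr.
  have /andP[g0 g1] := @diag_pot_diff_bound i j r t rpos isT (leq_maxl _ _) rM.
  rewrite ger0_norm//; apply: le_trans g1 _; have := re r rr; lra.
exists (2 * r0.+1 ^ 2)%N => i j h.
case: (leP 0 i) => i0.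
  have := main `|i|%N j.
  have -> : `|i|.+1%:Z = i + 1 by lia.
  rewrite gez0_abs//; apply.
  by move: h; rewrite /sqrad /=; nia.
(* For i < 0, reflection turns the pair i, i+1 into -i, -(i+1), based at the nonnegative -(i+1).
   This base is one unit closer to 0, which the successor in the threshold absorbs. *)
have := main (absz (i + 1)) j.
have -> : (absz (i + 1)).+1%:Z = - i by lia.
have -> : (absz (i + 1))%:Z = - (i + 1) by lia.
rewrite !diag_potNl distrC; apply.
move: h; rewrite /sqrad /=.
have [k ->] : exists k : nat, i = - k.+1%:Z by exists (`|i|.-1)%N; lia.
have -> : absz (- k.+1%:Z) = k.+1 by lia.
have -> : absz (- (- k.+1%:Z + 1)) = k by lia.
nia.
Qed.

End Gradient.

(** * The potential kernel *)

Section PotentialKernel.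
Context {R : realType}.
Local Notation pk := (@potential_kernel R).
Local Notation srw_prob := (@srw_prob R).
Implicit Types (x v w : Z2).

(** The sublattice parametrised by (i+j, i-j), which the walk from 0 visits at even times. All
    neighbours of a site outside it lie inside. *)
Definition even2 x : bool := ~~ odd `|x.1 + x.2|.

Lemma even2P x : even2 x -> exists i j : int, x = (i + j, i - j).
Proof.
case: x => x1 x2; rewrite /even2 /= => ev.
have [i hi] : exists i : int, x1 + x2 = i * 2.
  exists ((x1 + x2) %/ 2)%Z; lia.
by exists i, (i - x2); congr (_, _); lia.
Qed.

Lemma addZ2E (a b c d : int) : (a, b) + (c, d) = (a + c, b + d) :> Z2.
Proof. by []. Qed.

Lemma steps_cases e : e \in steps ->
  [\/ e = (1, 0), e = (-1, 0), e = (0, 1) | e = (0, -1)].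
Proof.
by rewrite !inE => /or4P[/eqP->|/eqP->|/eqP->|/eqP->];
  [constructor 1|constructor 2|constructor 3|constructor 4].
Qed.

Lemma even2_step x e : e \in steps -> even2 (x + e) = ~~ even2 x.
Proof.
by case: x => x1 x2 /steps_cases[] ->; rewrite addZ2E /even2 /=; lia.
Qed.

Lemma even2D x v : even2 v -> even2 (x + v) = even2 x.
Proof. by case: x => x1 x2; case: v => v1 v2; rewrite addZ2E /even2 /=; lia. Qed.

Lemma eq_avg (f g : Z2 -> R) x :
  (forall e, e \in steps -> f (x + e) = g (x + e)) -> avg f x = avg g x.
Proof. by move=> fg; congr (_ / _); apply: eq_big_seq. Qed.

Lemma avgB (f g : Z2 -> R) x : avg (fun y => f y - g y) x = avg f x - avg g x.
Proof. by rewrite /avg sumrB mulrBl. Qed.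

Lemma avg_cst (c : R) x : avg (fun=> c) x = c.
Proof. by rewrite avgE; field. Qed.

Lemma avg_sum (I : Type) (s : seq I) (f : I -> Z2 -> R) x :
  avg (fun y => \sum_(i <- s) f i y) x = \sum_(i <- s) avg (f i) x.
Proof. by rewrite /avg exchange_big /= mulr_suml. Qed.

Lemma avg_cvg (T : Type) (F : set_system T) (FF : Filter F) (f : T -> Z2 -> R)
    (l : Z2 -> R) x :
  (forall e, e \in steps -> f t (x + e) @[t --> F] --> l (x + e)) ->
  avg (f t) x @[t --> F] --> avg l x.
Proof.
move=> fl; apply: cvgMl; rewrite /steps !big_cons !big_nil.
rewrite (_ : (fun t => _) = fun t => f t (x + (1, 0)) + (f t (x + (-1, 0)) +
  (f t (x + (0, 1)) + (f t (x + (0, -1)) + 0)))); last first.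
  by apply/funext => t; rewrite !big_cons big_nil.
by do !(apply: cvgD; first by apply: fl; rewrite !inE eqxx ?orbT); exact: cvg_cst.
Qed.

Definition pk_sum (n : nat) x : R := \sum_(k < n.+1) (srw_prob k 0 - srw_prob k x).

Lemma srw_prob_even (m : nat) (i j : int) :
  srw_prob m.*2 (i + j, i - j) = diag m i * diag m j.
Proof.
rewrite srw_prob_walk1 /= /diag.
by congr (walk1 _ _ * walk1 _ _); lia.
Qed.

Lemma srw_prob_odd (m : nat) (i j : int) :
  srw_prob m.*2.+1 (i + j, i - j) = 0.
Proof.
rewrite srw_prob_walk1 (_ : _ + _ = i * 2) ?walk1_doubleS_even ?mul0r//=.
by lia.
Qed.

Lemma pk_sum_even (n : nat) (i j : int) :
  pk_sum n (i + j, i - j) = \sum_(m < n./2.+1) diag_deficit i j m.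
Proof.
suff H k : \sum_(k < k) (srw_prob k 0 - srw_prob k (i + j, i - j)) =
    \sum_(m < uphalf k) diag_deficit i j m by rewrite /pk_sum H.
have z0 : 0 = (0 + 0, 0 - 0) :> Z2 by [].
elim: k => [|k IH]; first by rewrite !big_ord0.
rewrite big_ord_recr /= {}IH z0.
have [m [->|->]] : exists m, k = m.*2 \/ k = m.*2.+1 by exists k./2; lia.
  rewrite !srw_prob_even !diag_0 uphalf_double doubleK big_ord_recr /=.
  by rewrite /diag_deficit expr2.
rewrite !srw_prob_odd subr0 addr0.
by have -> : uphalf m.*2.+1 = (m.*2.+1)./2.+1 by lia.
Qed.

Lemma half_cvgy : (n./2.+1 @[n --> \oo] --> \oo)%N.
Proof.
apply/cvgnyPge => A; near=> n.
have : (A.*2 <= n)%N by near: n; exact: nbhs_infty_ge.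
lia.
Unshelve. all: by end_near. Qed.

Lemma pk_sum_even_cvg (i j : int) :
  pk_sum n (i + j, i - j) @[n --> \oo] --> (diag_pot i j : R).
Proof.
rewrite (_ : (fun n => _) =
  (fun n => \sum_(m < n) diag_deficit i j m : R) \o (fun n => n./2.+1)).
  by apply: (cvg_comp _ _ half_cvgy); exact: diag_pot_cvg.
by apply/funext => n; exact: pk_sum_even.
Qed.

Lemma srw_prob0_cvg : srw_prob n 0 @[n --> \oo] --> 0.
Proof.
have z0 : 0 = (0 + 0, 0 - 0) :> Z2 by [].
apply: (@squeeze_cvgr _ _ _ _ (cst 0) (fun n => 2 * n.+1%:R^-1)); last 2 first.
- exact: cvg_cst.
- by rewrite -[X in _ --> X](mulr0 2); apply: cvgMr; exact: cvg_harmonic.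
near=> n; rewrite /=.
rewrite {1}srw_prob_walk1 mulr_ge0 ?walk1_ge0//= z0.
have n0 : (0 < n)%N by near: n; exact: nbhs_infty_gt.
have [m [nE|nE]] : exists m, n = m.*2 \/ n = m.*2.+1 by exists n./2; lia.
  have m0 : (0 < m)%N by lia.
  rewrite nE srw_prob_even !diag_0 -expr2.
  apply: le_trans (@central_sqr_le R _ m0) _.
  rewrite invfM.
  have p := @pi_inv_le_half R.
  have m0' : 0 < m%:R :> R by rewrite ltr0n.
  have n1' : 0 < m.*2.+1%:R :> R by rewrite ltr0n.
  apply: (@le_trans _ _ (2^-1 / m%:R)); first by rewrite ler_wpM2r// invr_ge0 ltW.
  rewrite -invfM -[leLHS]mul1r ler_pdivrMr ?mulr_gt0// mulrAC ler_pdivlMr// mul1r.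
  by rewrite -!natrM ler_nat; lia.
by rewrite nE srw_prob_odd mulr_ge0.
Unshelve. all: by end_near. Qed.

(** Averaging advances time by one, so the sums match after an index shift. The boundary term at
    time n+1 tends to 0, leaving the Laplacian of a as the unit mass at 0. *)
Lemma avg_pk_sum (n : nat) x :
  avg (pk_sum n) x = pk_sum n.+1 x - srw_prob n.+1 0 + srw_prob 0 x.
Proof.
rewrite /pk_sum avg_sum.
under eq_bigr => k _ do rewrite avgB avg_cst -srw_probS.
rewrite [in RHS]big_ord_recl /=.
under [in RHS]eq_bigr => k _ do rewrite /bump /= add1n.
rewrite !sumrB.
have : \sum_(k < n.+1) srw_prob k 0 + srw_prob n.+1 0 =
    srw_prob 0 0 + \sum_(k < n.+1) srw_prob k.+1 0.
  transitivity (\sum_(k < n.+2) srw_prob k 0); first by rewrite [RHS]big_ord_recr.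
  by rewrite [LHS]big_ord_recl.
lra.
Qed.

(** On even sites the partial sums are monotone and bounded. On the others, [avg_pk_sum] expresses
    them through the four neighbours, which are even. *)
Lemma pk_cvg x : pk_sum n x @[n --> \oo] --> pk x.
Proof.
suff : cvgn (pk_sum ^~ x) by [].
have ev y : even2 y -> cvgn (pk_sum ^~ y).
  by move=> /even2P[i [j ->]]; apply/cvgP/pk_sum_even_cvg.
have [|od] := boolP (even2 x); first exact: ev.
have : pk_sum n.+1 x @[n --> \oo] -->
    avg (fun y => limn (pk_sum ^~ y)) x + 0 - srw_prob 0 x.
  rewrite (_ : (fun n => _) =
    fun n => avg (pk_sum n) x + srw_prob n.+1 0 - srw_prob 0 x).
    apply: cvgB; last exact: cvg_cst.
    apply: cvgD; last by rewrite (cvg_shiftS (srw_prob ^~ 0)); exact: srw_prob0_cvg.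
    by apply: avg_cvg => e es; apply: ev; rewrite even2_step.
  by apply/funext => n; rewrite avg_pk_sum; lra.
by rewrite (cvg_shiftS (pk_sum ^~ x)) => /cvgP.
Qed.

Lemma pk_even (i j : int) : pk (i + j, i - j) = diag_pot i j.
Proof. by apply: cvg_lim => //; exact: pk_sum_even_cvg. Qed.

Lemma avg_pk x : avg pk x = pk x + (x == 0)%:R.
Proof.
have h1 : avg (pk_sum n) x @[n --> \oo] --> avg pk x.
  by apply: avg_cvg => e _; exact: pk_cvg.
have h2 : avg (pk_sum n) x @[n --> \oo] --> pk x - 0 + srw_prob 0 x.
  rewrite (_ : (fun n => _) = fun n => pk_sum n.+1 x - srw_prob n.+1 0 + srw_prob 0 x).
    apply: cvgD; last exact: cvg_cst.
    apply: cvgB; first by rewrite (cvg_shiftS (pk_sum ^~ x)); exact: pk_cvg.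
    by rewrite (cvg_shiftS (srw_prob ^~ 0)); exact: srw_prob0_cvg.
  by apply/funext => n; exact: avg_pk_sum.
by rewrite -(cvg_lim _ h1)// (cvg_lim _ h2)// subr0 srw_prob0.
Qed.

Lemma pk0 : pk 0 = 0.
Proof.
transitivity (pk (0 + 0, 0 - 0)); first by [].
rewrite pk_even /diag_pot.
rewrite (_ : (fun n => _) = cst 0) ?lim_cst//.
apply/funext => n; apply: big1 => m _.
by rewrite /diag_deficit diag_0 -expr2 subrr.
Qed.

Lemma pkN x : pk (- x) = pk x.
Proof.
congr (limn _); apply/funext => n; apply: eq_bigr => k _; congr (_ - _).
rewrite !srw_prob_walk1; case: x => x1 x2 /=.
have -> : - x1 + - x2 = - (x1 + x2) by lia.
have -> : - x1 - - x2 = - (x1 - x2) by lia.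
by rewrite !walk1N.
Qed.

Lemma pk_ge0 x : 0 <= pk x.
Proof.
have ev y : even2 y -> 0 <= pk y.
  by move=> /even2P[i [j ->]]; rewrite pk_even diag_pot_ge0.
have [|od] := boolP (even2 x); first exact: ev.
have := avg_pk x; case: eqP od => [->//|_] od; rewrite addr0 => <-.
rewrite divr_ge0// big_seq sumr_ge0// => e es.
by apply: ev; rewrite even2_step.
Qed.

End PotentialKernel.

(** * The potential kernel near infinity *)

Section Infinity.
Context {R : realType}.
Local Notation pk := (@potential_kernel R).
Local Notation at_infty := (@at_infty R).
Local Notation enorm := (@enorm R).
Implicit Types (x v w : Z2).

Lemma oppZ2E (a b : int) : - (a, b) = (- a, - b) :> Z2.
Proof. by []. Qed.

Lemma mulrnZ2E (a b : int) (k : nat) : (a, b) *+ k = (a * k%:Z, b * k%:Z) :> Z2.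
Proof.
elim: k => [|k IH]; first by rewrite mulr0n !mulr0.
by rewrite mulrS IH addZ2E; congr (_, _); lia.
Qed.

Lemma absz_sqrE (a : int) : (`|a| ^ 2)%N%:Z = a ^+ 2.
Proof. by rewrite -mulnn PoszM abszE -expr2 real_normK ?num_real. Qed.

Lemma absz_sqr_le (a b : int) :
  (`|a| ^ 2 <= 2 * `|(a + b)%R| ^ 2 + 2 * `|b| ^ 2)%N.
Proof.
have : (`|a| <= `|(a + b)%R| + `|b|)%N by lia.
rewrite -leq_sqr sqrnD => /leq_trans; apply.
move: (absz (a + b)) (absz b) => p q; have [+ _] := nat_Cauchy p q; lia.
Qed.

Lemma sqradC (i j : int) : sqrad i j = sqrad j i.
Proof. by rewrite /sqrad addnC. Qed.

Lemma sqrad_pred (i j : int) : (sqrad i j <= 2 * sqrad (i - 1) j + 2)%N.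
Proof.
have : (`|i| ^ 2 <= 2 * `|(i - 1)%R| ^ 2 + 2 * 1)%N := absz_sqr_le i (-1).
rewrite /sqrad.
by move: (_ ^ 2)%N (_ ^ 2)%N (_ ^ 2)%N; clear; lia.
Qed.

(** The squared norm is kept as a natural number, so that neighbourhoods of infinity and disks
    become comparisons in [nat]. *)
Definition nsq x : nat := (`|x.1| ^ 2 + `|x.2| ^ 2)%N.

Lemma nsq_even2 (i j : int) : nsq (i + j, i - j) = (2 * sqrad i j)%N.
Proof.
apply/eqP; rewrite -eqz_nat /nsq /sqrad PoszM !PoszD !absz_sqrE /=.
by apply/eqP; ring.
Qed.

Lemma enormE x : enorm x = Num.sqrt (nsq x)%:R.
Proof.
rewrite /Defs.enorm /nsq natrD !natrX.
by congr (Num.sqrt (_ + _)); rewrite -[LHS]real_normK ?num_real// -intr_norm -abszE.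
Qed.

Lemma enorm_le x (N : nat) : (enorm x <= N%:R) = (nsq x <= N ^ 2)%N.
Proof.
rewrite enormE -(ler_nat R) natrX -{1}(ger0_norm (ler0n R N)) -sqrtr_sqr.
by rewrite ler_sqrt// sqr_ge0.
Qed.

Lemma near_at_infty (P : set Z2) :
  (\forall x \near at_infty, P x) <-> exists M : nat, forall x, (M <= nsq x)%N -> P x.
Proof.
split=> [[r _ rP]|[M MP]].
  exists ((Num.truncn (Num.max r 0%R)).+1 ^ 2)%N => x hx; apply: rP => /=.
  have := truncnS_gt (Num.max r 0%R); set N := _.+1 in hx *.
  rewrite gt_max => /andP[rN _]; apply: (lt_le_trans rN).
  by rewrite enormE -(ger0_norm (ler0n R N)) -sqrtr_sqr ler_sqrt// -natrX ler_nat.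
exists M%:R => // x /=; rewrite ltNge enorm_le -ltnNge => hx; apply: MP.
by apply: leq_trans (ltnW hx); nia.
Qed.

Global Instance at_infty_filter : ProperFilter at_infty.
Proof.
apply: filter_from_proper.
  apply: filter_from_filter; first by exists 0.
  move=> r s _ _; exists (Num.max r s) => // x /=.
  by rewrite gt_max => /andP[].
move=> r _; have /near_at_infty[M MP] : at_infty [set x | r < enorm x] by exists r.
by exists (M%:Z, 0); apply: MP; rewrite /nsq /=; nia.
Qed.

Lemma at_infty_shift v : x + v @[x --> at_infty] --> at_infty.
Proof.
move=> P /near_at_infty[M MP]; apply/near_at_infty.
exists (2 * M + 2 * nsq v)%N => x hx; apply: MP.
have := absz_sqr_le x.1 v.1; have := absz_sqr_le x.2 v.2; move: hx; rewrite /nsq /=.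
move: (_ ^ 2)%N (_ ^ 2)%N (_ ^ 2)%N (_ ^ 2)%N (_ ^ 2)%N (_ ^ 2)%N.
clear; lia.
Qed.

(** The value 0 on odd sites lets a limit along the even sublattice be stated with the filter
    [at_infty]. *)
Definition pk_diff_even v x : R := if even2 x then pk (x + v) - pk x else 0.

Lemma pk_diff_evenD v w : even2 v ->
  pk_diff_even v x @[x --> at_infty] --> 0 ->
  pk_diff_even w x @[x --> at_infty] --> 0 ->
  pk_diff_even (v + w) x @[x --> at_infty] --> 0.
Proof.
move=> ev hv hw.
rewrite (_ : pk_diff_even (v + w) = fun x => pk_diff_even w (x + v) + pk_diff_even v x).
  rewrite -[X in _ --> X]addr0; apply: cvgD => //.
  exact: cvg_comp (at_infty_shift v) hw.
apply/funext => x; rewrite /pk_diff_even even2D//; case: ifP => _; last by rewrite addr0.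
by rewrite addrA; lra.
Qed.

(** Diagonal moves change a single one of the coordinates i, j by one unit, which is the increment
    controlled by [diag_pot_diff_small]. *)
Lemma pk_diff_even_diag (i j : int) :
  (i, j) \in [:: (1, 0); (-1, 0); (0, 1); (0, -1)] ->
  pk_diff_even (i + j, i - j) x @[x --> at_infty] --> 0.
Proof.
move=> ij; apply/cvgrPdist_le => eps e0; apply/near_at_infty.
have [rho H] := diag_pot_diff_small e0.
exists (2 * rho.+1 * 2)%N => x; rewrite sub0r normrN /pk_diff_even.
case: ifPn => [/even2P[k [l ->]]|_]; last by rewrite normr0 ltW.
rewrite addZ2E; have -> : k + l + (i + j) = (k + i) + (l + j) by lia.
have -> : k - l + (i - j) = (k + i) - (l + j) by lia.
rewrite !pk_even => hx.
have shift1 (a b : int) : (2 * rho.+1 <= sqrad a b)%N -> (rho <= sqrad (a - 1) b)%N.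
  by have := sqrad_pred a b; lia.
have hkl : (2 * rho.+1 <= sqrad k l)%N by rewrite nsq_even2 in hx; lia.
have hlk : (2 * rho.+1 <= sqrad l k)%N by rewrite sqradC.
have pred1 (a b : int) : (2 * rho.+1 <= sqrad a b)%N ->
    `|@diag_pot R (a - 1) b - diag_pot a b| <= eps.
  by move=> h; have := H (a - 1) b (shift1 _ _ h); rewrite subrK distrC.
move: ij; rewrite !inE => /or4P[] /eqP[-> ->]; rewrite ?addr0.
- by apply: H; lia.
- exact: pred1.
- by rewrite ![diag_pot k _]diag_potC; apply: H; lia.
- by rewrite ![diag_pot k _]diag_potC; apply: pred1.
Qed.

Lemma pk_diff_even_cvg v : even2 v -> pk_diff_even v x @[x --> at_infty] --> 0.
Proof.
have gen (d : Z2) : even2 d -> pk_diff_even d x @[x --> at_infty] --> 0 ->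
    forall (n : nat), pk_diff_even (d *+ n) x @[x --> at_infty] --> 0.
  move=> ed hd; elim=> [|n IH].
    rewrite mulr0n (_ : pk_diff_even 0 = cst 0); first exact: cvg_cst.
    by apply/funext => x; rewrite /pk_diff_even addr0 subrr; case: ifP.
  by rewrite mulrS; apply: pk_diff_evenD.
have genz (i j : int) (n : int) :
    (i, j) \in [:: (1, 0); (-1, 0); (0, 1); (0, -1)] ->
    (- i, - j) \in [:: (1, 0); (-1, 0); (0, 1); (0, -1)] ->
    pk_diff_even ((i + j, i - j) *~ n) x @[x --> at_infty] --> 0.
  move=> h1 h2; have ed (a b : int) : even2 (a + b, a - b) by rewrite /even2 /=; lia.
  case: n => n; first exact: gen (ed _ _) (pk_diff_even_diag h1) n.
  rewrite NegzE mulrNz -mulNrz -[_ *~ _]/(_ *+ n.+1).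
  have -> : - (i + j, i - j) = (- i + - j, - i - - j) :> Z2.
    by rewrite oppZ2E; congr (_, _); lia.
  exact: gen (ed _ _) (pk_diff_even_diag h2) n.+1.
move=> /even2P[i [j ->]].
have mulE (a b : int) (n : int) : (a, b) *~ n = (a * n, b * n) :> Z2.
  case: n => k; first exact: mulrnZ2E.
  rewrite NegzE mulrNz -[_ *~ _]/(_ *+ k.+1) mulrnZ2E oppZ2E.
  by congr (_, _); lia.
(* The vectors (1,1) and (1,-1) generate the even sublattice. *)
have -> : (i + j, i - j) = (1 + 0, 1 - 0) *~ i + (0 + 1, 0 - 1) *~ j :> Z2.
  by rewrite !mulE addZ2E; congr (_, _); lia.
apply: pk_diff_evenD; [|exact: genz|exact: genz].
by rewrite mulE /even2 /=; lia.
Qed.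

(** One of [x], [x + e] is odd; harmonicity replaces the kernel there by its mean over even sites,
    at even displacement from the other point. In [F] each average serves one parity of [x] and
    vanishes for the other. *)
Lemma pk_step_cvg e : e \in steps -> pk (x + e) - pk x @[x --> at_infty] --> 0.
Proof.
move=> es.
pose F x := avg (fun d => pk_diff_even (e + d) x) 0 -
            avg (fun d => pk_diff_even (d - e) (x + e)) 0.
have F0 : F x @[x --> at_infty] --> 0.
  have -> : 0 = avg (fun=> 0) 0 - avg (fun=> 0) 0 :> R by rewrite avg_cst subrr.
  have ne d : d \in steps -> - d \in steps.
    by move=> /steps_cases[] ->.
  have e0 d : d \in steps -> ~~ even2 d.
    by move=> h; rewrite -[d]add0r even2_step.
  apply: cvgB; apply: avg_cvg => d ds; rewrite add0r.
    by apply: pk_diff_even_cvg; rewrite even2_step// e0.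
  have ede : even2 (d - e) by rewrite even2_step ?ne// e0.
  exact: cvg_comp (at_infty_shift e) (pk_diff_even_cvg ede).
apply: cvg_trans F0; apply: near_eq_cvg.
(* This keeps [x] and [x + e] away from 0, where the mean value property fails. *)
apply/near_at_infty; exists 2%N => x hx.
have x0 : x != 0 by apply: contraTneq hx => ->.
have xe0 : x + e != 0.
  apply: contraTneq hx => /eqP; rewrite addr_eq0 => /eqP ->.
  by move: es => /steps_cases[] ->.
rewrite /F /pk_diff_even even2_step//.
have avgD (f : Z2 -> R) (y : Z2) : avg (fun d => f (y + d)) 0 = avg f y.
  by congr (_ / _); apply: eq_bigr => d _; rewrite add0r.
have pkavg y : y != 0 -> pk y = avg (fun d => pk (y + d)) 0.
  by move=> /negbTE y0; rewrite avgD avg_pk y0 addr0.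
case: (boolP (even2 x)) => ev /=; rewrite avg_cst.
  rewrite subr0 avgB avg_cst (pkavg (x + e))//; congr (_ - _).
  by congr (_ / _); apply: eq_bigr => d _; rewrite !add0r addrA.
rewrite sub0r avgB avg_cst (pkavg x)// opprB; congr (_ - _).
congr (_ / _); apply: eq_bigr => d _; rewrite !add0r addrA.
by congr pk; rewrite addrAC addrK.
Qed.

Lemma pk_shift_cvg v : pk (x + v) - pk x @[x --> at_infty] --> 0.
Proof.
have comp d e : pk (x + d) - pk x @[x --> at_infty] --> 0 ->
    pk (x + e) - pk x @[x --> at_infty] --> 0 ->
    pk (x + (d + e)) - pk x @[x --> at_infty] --> 0.
  move=> hd he; rewrite (_ : (fun x => _) =
    fun x => (pk ((x + d) + e) - pk (x + d)) + (pk (x + d) - pk x)).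
    rewrite -[X in _ --> X]addr0; apply: cvgD => //.
    exact: cvg_comp (at_infty_shift d) he.
  by apply/funext => x; rewrite addrA; lra.
have gen e (n : nat) : e \in steps -> pk (x + e *+ n) - pk x @[x --> at_infty] --> 0.
  move=> es; elim: n => [|n IH].
    rewrite mulr0n (_ : (fun x => _) = cst 0); first exact: cvg_cst.
    by apply/funext => x; rewrite addr0 subrr.
  by rewrite mulrS; apply: comp => //; exact: pk_step_cvg.
case: v => v1 v2.
have -> : (v1, v2) = (v1, 0) + (0, v2) :> Z2 by rewrite addZ2E addr0 add0r.
apply: comp.
  case: v1 => n.
    have -> : (Posz n, 0) = (1, 0) *+ n :> Z2 by rewrite mulrnZ2E mul1r mul0r.
    exact: gen.
  have -> : (Negz n, 0) = (-1, 0) *+ n.+1 :> Z2.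
    by rewrite mulrnZ2E mul0r NegzE mulN1r.
  exact: gen.
case: v2 => n.
  have -> : (0, Posz n) = (0, 1) *+ n :> Z2 by rewrite mulrnZ2E mul1r mul0r.
  exact: gen.
have -> : (0, Negz n) = (0, -1) *+ n.+1 :> Z2.
  by rewrite mulrnZ2E mul0r NegzE mulN1r.
exact: gen.
Qed.

Lemma pk_ln_even x : (0 < nsq x)%N -> even2 x ->
  `|pk x - pi^-1 * ln (nsq x)%:R| <= 4.
Proof.
move=> h /even2P[i [j xE]]; move: h; rewrite xE nsq_even2 pk_even => h.
have M0 : (0 < sqrad i j)%N by move: h; rewrite muln_gt0.
have := @diag_pot_ln R i j M0; rewrite natrM lnM ?posrE ?ltr0n//.
have l2 : 0 <= ln (2 : R) <= 1.
  rewrite ln_ge0 ?ler1n//=; have := @le_ln1Dx R 1 (lt_trans (ltrN10 _) ltr01).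
  by rewrite -natr1.
have p := @pi_inv_le_half R; have p0 := @pi_inv_gt0 R.
rewrite !ler_distl; move: (ln (2 : R)) (ln (sqrad i j)%:R) (diag_pot i j) l2.
move=> u l a /andP[u0 u1].
have : pi^-1 * u <= 1 * 1 by apply: ler_pM => //; lra.
have : 0 <= pi^-1 * u by rewrite mulr_ge0// ltW.
lra.
Qed.

Lemma ln4 : 0 <= ln (4 : R) <= 2.
Proof.
rewrite ln_ge0 ?ler1n//=.
have := @le_ln1Dx R 1 (lt_trans (ltrN10 _) ltr01).
have -> : (4 : R) = (1 + 1) * (1 + 1) by lra.
by rewrite lnM ?posrE//; lra.
Qed.

Lemma sum_sqr_near (a b c : nat) :
  (a <= c.+1)%N -> (c <= a.+1)%N -> (4 <= a ^ 2 + b ^ 2)%N ->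
  (a ^ 2 + b ^ 2 <= 4 * (c ^ 2 + b ^ 2) <= 16 * (a ^ 2 + b ^ 2))%N.
Proof.
have sq (m n : nat) : (m <= n.+1 -> m * m <= 2 * (n * n) + 2)%N.
  move=> mn; apply: leq_trans (leq_mul mn mn) _.
  by case: n {mn} => // n; nia.
rewrite -!mulnn => /sq ac /sq ca h; apply/andP; split; last by lia.
case: b h => [|b] h; last by lia.
case: c ac ca => [|c] ac ca; lia.
Qed.

(** At an odd site, average the even bound 4 over the neighbours: their squared norms agree with
    that of [x] up to a factor 4, and (ln 4)/pi <= 1. *)
Lemma pk_ln_bound x : (4 <= nsq x)%N -> `|pk x - pi^-1 * ln (nsq x)%:R| <= 6.
Proof.
move=> hx.
have hx0 : (0 < nsq x)%N by apply: leq_trans hx.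
have [/(pk_ln_even hx0)|od] := boolP (even2 x); first by move=> /le_trans; apply; lra.
have x0 : (x == 0) = false by apply/negbTE; apply: contraTneq hx => ->.
have p := @pi_inv_le_half R; have p0 := @pi_inv_gt0 R.
have near e : e \in steps -> (nsq x <= 4 * nsq (x + e)%R <= 16 * nsq x)%N.
  have up (a : int) : (`|a| <= `|(a + 1)%R|.+1)%N && (`|(a + 1)%R| <= `|a|.+1)%N by lia.
  have dn (a : int) : (`|a| <= `|(a - 1)%R|.+1)%N && (`|(a - 1)%R| <= `|a|.+1)%N by lia.
  move: hx; clear -up dn; case: x => x1 x2; rewrite /nsq /= => hx.
  move=> /steps_cases[] -> /=; rewrite addr0.
  - by have /andP[? ?] := up x1; exact: sum_sqr_near.
  - by have /andP[? ?] := dn x1; exact: sum_sqr_near.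
  - rewrite ![(`|x1| ^ 2 + _)%N]addnC in hx *.
    by have /andP[? ?] := up x2; exact: sum_sqr_near.
  - rewrite ![(`|x1| ^ 2 + _)%N]addnC in hx *.
    by have /andP[? ?] := dn x2; exact: sum_sqr_near.
have st e : e \in steps -> `|pk (x + e) - pi^-1 * ln (nsq x)%:R| <= 6.
  move=> es; have /andP[n1 n2] := near e es.
  have n0 : (0 < nsq (x + e)%R)%N by lia.
  have := pk_ln_even n0; rewrite even2_step// => /(_ od).
  have l1 : ln (nsq x)%:R <= ln 4 + ln (nsq (x + e))%:R :> R.
    by rewrite -lnM ?posrE ?ltr0n// -natrM ler_ln ?posrE ?ltr0n ?ler_nat//; lia.
  have l2 : ln (nsq (x + e))%:R <= ln 4 + ln (nsq x)%:R :> R.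
    by rewrite -lnM ?posrE ?ltr0n// -natrM ler_ln ?posrE ?ltr0n ?ler_nat//; lia.
  have := ln4.
  rewrite !ler_distl; move: (ln _) (ln _) (ln _) (pk _) l1 l2 => u v w a l1 l2; nra.
have := @avg_pk R x; rewrite x0 addr0 => <-.
have s (d : Z2) := st d; rewrite avgE.
have := s (1, 0) isT; have := s (-1, 0) isT; have := s (0, 1) isT.
have := s (0, -1) isT; case: x {hx hx0 od x0 near st s} => x1 x2.
rewrite !addZ2E !addr0 /= !ler_distl; lra.
Qed.

Lemma pk_cvgy : pk x @[x --> at_infty] --> +oo.
Proof.
apply/cvgryPge => A; apply/near_at_infty.
have p0 := @pi_inv_gt0 R; have pp := @pi_gt0 R.
pose M := (Num.truncn (expR (pi * (A + 6)))).+1.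
exists (4 + M)%N => x hx.
have := @pk_ln_bound x; have -> : (4 <= nsq x)%N by lia.
move=> /(_ isT); rewrite ler_distl => /andP[+ _]; apply: le_trans.
have : pi * (A + 6) <= ln (nsq x)%:R.
  have n0 : 0 < (nsq x)%:R :> R by rewrite ltr0n; lia.
  rewrite -[leLHS]expRK ler_ln ?posrE ?expR_gt0//.
  apply: (@le_trans _ _ M%:R); last by rewrite ler_nat; lia.
  exact/ltW/truncnS_gt.
by move=> /(ler_wpM2l (ltW p0)); rewrite mulKf ?gt_eqF//; lra.
Qed.

End Infinity.

(** * Harmonic functions on Z^2 *)

Section Harmonic.
Context {R : realType}.
Local Notation pk := (@potential_kernel R).
Local Notation at_infty := (@at_infty R).
Implicit Types (x v w : Z2) (f : Z2 -> R) (s D : seq Z2).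

(* Ties are broken by the first coordinate, so that the right neighbour of the
   maximiser is strictly smaller. *)
Lemma lex_argmax f s x : x \in s -> exists2 w, w \in s &
  forall v, v \in s -> f v < f w \/ f v = f w /\ v.1 <= w.1.
Proof.
elim: s x => // u s IH x _.
case: s IH => [_|u' s IH].
  by exists u; rewrite ?inE// => v; rewrite inE => /eqP->; right.
have [w ws wmax] := IH u' (mem_head _ _).
have [uw|wu|uw] := ltgtP (f u) (f w).
- exists w => [|v]; first by rewrite inE ws orbT.
  by rewrite inE => /predU1P[->|/wmax//]; left.
- exists u => [|v]; first by rewrite inE eqxx.
  rewrite inE => /predU1P[->|/wmax vw]; first by right.
  by left; case: vw => [vw|[-> _]//]; exact: lt_trans wu.
- have [le1|lt1] := leP u.1 w.1.
    exists w => [|v]; first by rewrite inE ws orbT.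
    by rewrite inE => /predU1P[->|/wmax//]; right.
  exists u => [|v]; first by rewrite inE eqxx.
  rewrite inE => /predU1P[->|/wmax]; first by right.
  by rewrite uw => -[|[-> /le_lt_trans/(_ lt1)/ltW]]; [left|right].
Qed.

(** If the maximum over [D] were positive, then at the maximiser of largest first coordinate the
    right neighbour would be strictly smaller and the others no larger, against the sub-mean
    inequality. *)
Lemma maximum_principle f D : (forall x, x \in D -> f x <= avg f x) ->
  (forall x e, x \in D -> e \in steps -> x + e \notin D -> f (x + e) <= 0) ->
  forall x, x \in D -> f x <= 0.
Proof.
move=> sub bd x xD; have [w wD wmax] := lex_argmax f xD.
have fxw : f x <= f w by have [/ltW|[->]] := wmax _ xD.
apply: le_trans fxw _; rewrite leNgt; apply/negP => fw0.
have le e : e \in steps -> f (w + e) <= f w.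
  move=> es; have [wD'|wD'] := boolP (w + e \in D).
    by have [/ltW|[->]] := wmax _ wD'.
  exact: le_trans (bd _ _ wD es wD') (ltW fw0).
have lt1 : f (w + (1, 0)) < f w.
  have [wD'|wD'] := boolP (w + (1, 0) \in D); last first.
    by apply: (le_lt_trans _ fw0); apply: bd.
  have [//|[_ /=]] := wmax _ wD'; lia.
have := sub _ wD; rewrite avgE.
have := le (-1, 0) isT; have := le (0, 1) isT; have := le (0, -1) isT.
move: lt1; case: w {wD wmax fw0 le} => w1 w2.
rewrite !addZ2E !addr0 /=; lra.
Qed.

Lemma disk_seq (M : nat) : exists s, forall x, (x \in s) = (nsq x < M)%N.
Proof.
pose r := [seq k%:Z - M%:Z | k <- iota 0 (2 * M).+1].
have rP (a : int) : (`|a| < M)%N -> a \in r.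
  move=> aM; apply/mapP; exists (absz (a + M%:Z)); last by lia.
  by rewrite mem_iota; lia.
exists [seq x <- [seq (a, b) | a <- r, b <- r] | (nsq x < M)%N] => x.
rewrite mem_filter andb_idr// => xM; apply/allpairsP.
have sq (k : nat) : (k <= k ^ 2)%N by case: k => // k; rewrite -mulnn; nia.
exists x; rewrite !rP; first by case: x {xM}.
  by apply: leq_ltn_trans xM; apply: leq_trans (sq _) _; rewrite leq_addl.
by apply: leq_ltn_trans xM; apply: leq_trans (sq _) _; rewrite leq_addr.
Qed.

Lemma avgD f g x : avg (fun y => f y + g y) x = avg f x + avg g x.
Proof. by rewrite /avg big_split mulrDl. Qed.

Lemma avgZ (c : R) f x : avg (fun y => c * f y) x = c * avg f x.
Proof. by rewrite /avg -mulr_sumr mulrA. Qed.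

Lemma avg_shift f v x : avg (fun y => f (y + v)) x = avg f (x + v).
Proof. by congr (_ / _); apply: eq_bigr => e _; rewrite addrAC. Qed.

Lemma avg_pk_shift v x : avg (fun y => pk (y - v)) x = pk (x - v) + (x == v)%:R.
Proof. by rewrite avg_shift avg_pk subr_eq0. Qed.

(** The potential kernel is a barrier: it is harmonic off 0, zero at 0 and unbounded, so eps a
    dominates both f and -f on a large disk with 0 removed. Then eps tends to 0. *)
Lemma bounded_harmonic_off0_eq0 f (B : R) :
  (forall x, x != 0 -> avg f x = f x) -> f 0 = 0 ->
  (\forall x \near at_infty, `|f x| <= B) -> forall x, f x = 0.
Proof.
move=> hf f0 fB x.
have key (eps : R) : 0 < eps -> `|f x| <= eps * pk x.
  move=> e0.
  have [M MP] : exists M : nat, forall y, (M <= nsq y)%N -> `|f y| <= eps * pk y.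
    apply/near_at_infty; near=> y.
    apply: (@le_trans _ _ B); first by near: y; exact: fB.
    rewrite -ler_pdivrMl//; near: y.
    by move/cvgryPge: (@pk_cvgy R) => /(_ (eps^-1 * B)).
  have [s sP] := disk_seq (M + nsq x).+1.
  pose D := [seq y <- s | y != 0].
  have [->|x0] := eqVneq x 0; first by rewrite f0 normr0 mulr_ge0 ?pk_ge0// ltW.
  have xD : x \in D by rewrite mem_filter x0 sP ltnS leq_addl.
  have gen (c : R) : `|c| = 1 -> c * f x <= eps * pk x.
    move=> c1; rewrite -subr_le0.
    apply: (@maximum_principle (fun y => c * f y - eps * pk y) D) => //.
      move=> y; rewrite mem_filter => /andP[y0 _].
      by rewrite avgB !avgZ hf// avg_pk (negbTE y0) addr0.
    move=> y e _ _; rewrite mem_filter negb_and negbK sP -leqNgt subr_le0.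
    move=> /orP[/eqP->|ny]; first by rewrite f0 pk0 !mulr0.
    apply: le_trans (ler_norm _) _; rewrite normrM c1 mul1r; apply: MP.
    by apply: leq_trans ny; rewrite leqW// leq_addr.
  rewrite ler_norml -{1}[f x]mul1r -[_ * f x]opprK lerN2 -mulNr.
  by rewrite gen ?normrN1// -[f x]mul1r gen// normr1.
apply/eqP; rewrite -normr_le0; apply/ler_addgt0Pl => eps e0; rewrite addr0.
have p1 : 0 < pk x + 1 by rewrite ltr_wpDl ?pk_ge0.
have := key (eps / (pk x + 1)) (divr_gt0 e0 p1) => /le_trans; apply.
rewrite mulrAC ler_pdivrMr// ler_pM2l//; lra.
Unshelve. all: by end_near. Qed.

(** The function f - f(0) - lam a is bounded near infinity, harmonic off 0 and zero at 0, hence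
    vanishes identically. *)
Lemma harmonic_const f (lam B : R) : (forall x, avg f x = f x) ->
  (\forall x \near at_infty, `|f x - lam * pk x| <= B) ->
  lam = 0 /\ forall x, f x = f 0.
Proof.
move=> hf fB.
have phi0 x : f x - f 0 - lam * pk x = 0.
  apply: (@bounded_harmonic_off0_eq0 (fun x => f x - f 0 - lam * pk x) (B + `|f 0|)).
  - move=> {}x x0; rewrite avgB avgB avg_cst avgZ hf avg_pk.
    by rewrite (negbTE x0) addr0.
  - by rewrite subrr pk0 mulr0 subr0.
  - near=> y; rewrite addrAC; apply: le_trans (ler_normB _ _) _.
    by rewrite lerD2r; near: y; exact: fB.
(* At 0 the Laplacian of f is zero while that of lam a is lam. *)
have l0 : lam = 0.
  have := hf 0; rewrite (_ : avg f 0 = avg (fun x => f 0 + lam * pk x) 0).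
    rewrite avgD avg_cst avgZ avg_pk pk0 eqxx add0r mulr1; lra.
  by apply: eq_avg => e _; have := phi0 (0 + e); lra.
by split=> // x; have := phi0 x; rewrite l0; lra.
Unshelve. all: by end_near. Qed.

Lemma pk_shift_bounded v :
  exists B : R, \forall x \near at_infty, `|pk (x - v) - pk x| <= B.
Proof.
exists 1; have /cvgrPdist_le /(_ _ ltr01) := @pk_shift_cvg R (- v).
by apply: filterS => x; rewrite sub0r normrN.
Qed.

(* Subtracting the potential of the Laplacian of [f] leaves a function that is
   harmonic everywhere. *)
Lemma harmonic_off_repr f s (lam B : R) : uniq s ->
  (forall x, x \notin s -> avg f x = f x) ->
  (\forall x \near at_infty, `|f x - lam * pk x| <= B) ->
  \sum_(x <- s) (avg f x - f x) = lam /\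
  exists c, forall w, f w = c + \sum_(x <- s) (avg f x - f x) * pk (w - x).
Proof.
move=> us hf fB; pose nu x := avg f x - f x.
pose G w := f w - \sum_(x <- s) nu x * pk (w - x).
have hG w : avg G w = G w.
  rewrite avgB avg_sum /G.
  under eq_bigr => x _ do rewrite avgZ avg_pk_shift mulrDr.
  rewrite big_split /=.
  have -> : \sum_(x <- s) nu x * (w == x)%:R = if w \in s then nu w else 0.
    have [ws|ws] := ifPn.
      rewrite (bigD1_seq w) //= eqxx mulr1 big1 ?addr0// => x xw.
      by rewrite eq_sym (negbTE xw) mulr0.
    rewrite big_seq big1// => x xs; rewrite (_ : (w == x) = false) ?mulr0//.
    by apply: contraNF ws => /eqP ->.
  case: ifPn => [_|ws]; last by rewrite addr0 hf.
  rewrite opprD addrA [nu w]/nu opprB addrAC.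
  by rewrite addrCA subrr addr0.
have [C nearC] : exists C, \forall w \near at_infty,
    `|\sum_(x <- s) nu x * (pk (w - x) - pk w)| <= C.
  elim: s {us hf G hG} => [|x s [C IH]].
    by exists 0; apply: nearW => w; rewrite big_nil normr0.
  have [D hD] := pk_shift_bounded x.
  exists (`|nu x| * D + C); near=> w; rewrite big_cons.
  apply: le_trans (ler_normD _ _) _; apply: lerD; last by near: w; exact: IH.
  by rewrite normrM ler_wpM2l//; near: w; exact: hD.
(* Shifting the kernel costs O(1), so the subtracted potential grows like its total mass times a.
   [harmonic_const] then yields both the mass and the constant. *)
have GB : \forall w \near at_infty,
    `|G w - (lam - \sum_(x <- s) nu x) * pk w| <= B + C.
  near=> w; have -> : G w - (lam - \sum_(x <- s) nu x) * pk w =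
     (f w - lam * pk w) - \sum_(x <- s) nu x * (pk (w - x) - pk w).
    have -> : \sum_(x <- s) nu x * (pk (w - x) - pk w) =
        \sum_(x <- s) nu x * pk (w - x) - (\sum_(x <- s) nu x) * pk w.
      by rewrite mulr_suml -sumrB; apply: eq_bigr => x _; rewrite mulrBr.
    by rewrite /G; ring.
  by apply: le_trans (ler_normB _ _) _; apply: lerD; near: w; [exact: fB|exact: nearC].
have [l0 Gc] := harmonic_const hG GB.
split; first by apply/esym/eqP; rewrite -subr_eq0 l0.
by exists (G 0) => w; rewrite -(Gc w) /G subrK.
Unshelve. all: by end_near. Qed.

End Harmonic.

(** * Hitting distributions and escape probabilities *)

Lemma cvg_sum_seq (R : realType) (T : Type) (I : eqType) (F : set_system T)
    {FF : Filter F} (r : seq I) (f : I -> T -> R) (l : I -> R) :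
  (forall i, i \in r -> f i t @[t --> F] --> l i) ->
  \sum_(i <- r) f i t @[t --> F] --> \sum_(i <- r) l i.
Proof.
elim: r => [|i r IH] fl.
  rewrite big_nil (_ : (fun t => _) = cst 0); first exact: cvg_cst.
  by apply/funext => t; rewrite big_nil.
rewrite big_cons (_ : (fun t => _) = fun t => f i t + \sum_(j <- r) f j t).
  apply: cvgD; first by apply: fl; rewrite mem_head.
  by apply: IH => j jr; apply: fl; rewrite inE jr orbT.
by apply/funext => t; rewrite big_cons.
Qed.

Section HittingDistribution.
Context {R : realType}.
Local Notation pk := (@potential_kernel R).
Local Notation at_infty := (@at_infty R).
Variables (s : seq Z2) (h : Z2 -> Z2 -> R) (b : Z2).
Hypothesis s_uniq : uniq s.
Hypothesis h_on : forall x w, x \in s -> w \in s -> h x w = (w == x)%:R.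
Hypothesis h_harm : forall x w, x \in s -> w \notin s -> avg (h x) w = h x w.
Hypothesis h_bound : forall x w, 0 <= h x w <= 1.
Hypothesis bs : b \in s.

(** [h x w] stands for the probability, started at w, of entering [s] at x; the section hypotheses
    are what is retained of it. *)
Definition green (w : Z2) : R :=
  pk (w - b) - \sum_(x <- s) h x w * pk (x - b).

Lemma green_on w : w \in s -> green w = 0.
Proof.
move=> ws; rewrite /green (bigD1_seq w)//= h_on// eqxx mul1r big_seq_cond.
rewrite big1 ?addr0 ?subrr// => x /andP[xs xw].
by rewrite h_on// eq_sym (negbTE xw) mul0r.
Qed.

Lemma green_harmonic w : w \notin s -> avg green w = green w.
Proof.
move=> ws; rewrite /green avgB avg_pk_shift avg_sum (_ : (w == b) = false); last first.
  by apply: contraNF ws => /eqP ->.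
rewrite addr0; congr (_ - _); rewrite !big_seq; apply: eq_bigr => x xs.
rewrite -(h_harm xs ws) mulrC -avgZ; congr (_ / _).
by apply: eq_bigr => e _; rewrite mulrC.
Qed.

Lemma green_near : exists B : R, \forall w \near at_infty, `|green w - 1 * pk w| <= B.
Proof.
have [B hB] := @pk_shift_bounded R b.
exists (B + \sum_(x <- s) pk (x - b)); near=> w.
rewrite /green mul1r addrAC; apply: le_trans (ler_normB _ _) _; apply: lerD.
  by near: w; exact: hB.
apply: le_trans (ler_norm_sum _ _ _) _; apply: ler_sum => x _.
have /andP[h0 h1] := h_bound x w.
by rewrite normrM (ger0_norm h0) (ger0_norm (pk_ge0 _)) ler_piMl// pk_ge0.
Unshelve. all: by end_near. Qed.

(** On [s] the function [green] vanishes, so its Laplacian there is [avg green]. The mass is the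
    coefficient 1 of a at infinity, and on [s] the representation reads 0 = c + potential. *)
Lemma green_equilibrium : \sum_(x <- s) avg green x = 1 /\
  exists C, forall w, w \in s -> \sum_(x <- s) avg green x * pk (w - x) = C.
Proof.
have [B hB] := green_near.
have [sum1 [c gE]] := harmonic_off_repr s_uniq green_harmonic hB.
have avgE' (F : Z2 -> R) :
    \sum_(x <- s) (avg green x - green x) * F x = \sum_(x <- s) avg green x * F x.
  by rewrite big_seq [RHS]big_seq; apply: eq_bigr => x xs; rewrite green_on// subr0.
split.
  by rewrite -sum1 big_seq [RHS]big_seq; apply: eq_bigr => x xs; rewrite green_on// subr0.
exists (- c) => w ws; have := gE w; rewrite green_on// avgE'; lra.
Qed.

(* Pairing the representation of [h x] with the equilibrium measure, whose
   potential is constant on [s], identifies the limit. *)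
Lemma hitting_cvg x : x \in s -> h x w @[w --> at_infty] --> avg green x.
Proof.
move=> xs; have [sum1 [C eqC]] := green_equilibrium.
have hb : \forall w \near at_infty, `|h x w - 0 * pk w| <= 1.
  apply: nearW => w; rewrite mul0r subr0.
  by have /andP[h0 h1] := h_bound x w; rewrite ger0_norm.
have [sum0 [c hE]] := harmonic_off_repr s_uniq (fun w => @h_harm x w xs) hb.
set nu := fun x' => avg (h x) x' - h x x' in sum0 hE.
(* Integrate h x against the equilibrium measure in two ways: by its boundary values on [s], and by
   its representation. *)
have cE : c = avg green x.
  have lhs : \sum_(w <- s) avg green w * h x w = avg green x.
    rewrite (bigD1_seq x)//= h_on// eqxx mulr1 big_seq_cond big1 ?addr0//.
    by move=> w /andP[ws wx]; rewrite h_on// (negbTE wx) mulr0.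
  rewrite -lhs; under eq_bigr => w _ do rewrite hE mulrDr.
  rewrite big_split /= -mulr_suml sum1 mul1r.
  under [X in _ = c + X]eq_bigr => w _ do rewrite mulr_sumr.
  (* By symmetry of the kernel the inner sum is the constant [C], and [nu] has total mass 0, so only
     c survives. *)
  rewrite exchange_big /= big_seq.
  under eq_bigr => x' x's.
    under eq_bigr => w _.
      rewrite mulrCA -(opprB x' w) pkN.
      over.
    rewrite -mulr_sumr eqC//.
    over.
  by rewrite -big_seq -mulr_suml sum0 mul0r addr0.
rewrite -cE.
(* Zero total mass allows pk w to be subtracted from every term, leaving increments that vanish at
   infinity. *)
have hE' w : h x w = c + \sum_(x' <- s) nu x' * (pk (w + (- x')) - pk w).
  rewrite hE; congr (c + _); under [RHS]eq_bigr => x' _ do rewrite mulrBr.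
  by rewrite sumrB -mulr_suml sum0 mul0r subr0.
rewrite (_ : h x = fun w => c + \sum_(x' <- s) nu x' * (pk (w + (- x')) - pk w));
  last exact/funext.
rewrite -[X in _ --> X]addr0; apply: cvgD; first exact: cvg_cst.
have z : \sum_(x' <- s) nu x' * 0 = 0 by rewrite big1// => ? _; rewrite mulr0.
rewrite -[X in _ --> X]z.
apply: cvg_sum_seq => x' _.
by apply: cvgMr; exact: pk_shift_cvg.
Qed.

End HittingDistribution.

(** * Asymptotics of escape from large disks *)

Section Escape.
Context {R : realType}.
Local Notation pk := (@potential_kernel R).
Local Notation at_infty := (@at_infty R).
Variables (s : seq Z2) (phi : Z2 -> R) (B : R) (F : nat -> Z2 -> R) (N0 : nat).
Local Notation disk N x := (nsq x <= N ^ 2)%N.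
Hypothesis phi_on : forall w, w \in s -> phi w = 0.
Hypothesis phi_harm : forall w, w \notin s -> avg phi w = phi w.
Hypothesis phi_near : \forall w \near at_infty, `|phi w - 1 * pk w| <= B.
Hypothesis F_on : forall N w, (N0 <= N)%N -> w \in s -> F N w = 0.
Hypothesis F_out : forall N w, (N0 <= N)%N -> ~~ disk N w -> F N w = 1.
Hypothesis F_harm : forall N w, (N0 <= N)%N -> disk N w -> w \notin s ->
  avg (F N) w = F N w.
Hypothesis F_ge0 : forall N w, 0 <= F N w.

Lemma nsq_step (N : nat) x e : e \in steps -> disk N x -> disk N.+1 (x + e)%R.
Proof.
move=> es hx; case: x hx => x1 x2; rewrite /nsq /= => hx.
have le a (b : nat) : (a ^ 2 + b <= N ^ 2 -> a <= N)%N.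
  by move=> h1; rewrite -leq_sqr; apply: leq_trans h1; rewrite leq_addr.
have sq (a : nat) (c b : nat) : (c <= a.+1 -> a ^ 2 + b <= N ^ 2 ->
    c ^ 2 + b <= N.+1 ^ 2)%N.
  move=> ca h1; have aN := le _ _ h1.
  have c2 : (c ^ 2 <= a.+1 ^ 2)%N by rewrite leq_sqr.
  by move: c2 h1; rewrite -!mulnn; nia.
have h2 : (`|x2| ^ 2 + `|x1| ^ 2 <= N ^ 2)%N by rewrite addnC.
case: (steps_cases es) => -> /=; rewrite addr0.
- by apply: sq hx; clear; lia.
- by apply: sq hx; clear; lia.
- by rewrite addnC; apply: sq h2; clear; lia.
- by rewrite addnC; apply: sq h2; clear; lia.
Qed.

Local Notation L N := (2 / pi * ln (N%:R : R)).

(** A site just outside the disk has squared norm between N^2 and 4 N^2. The 7 is the 6 of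
    [pk_ln_bound] plus (ln 4)/pi <= 1. *)
Lemma phi_boundary : exists M : nat, forall N x, (M <= N)%N ->
  ~~ disk N x -> disk N.+1 x -> `|phi x - L N| <= B + 7.
Proof.
have /near_at_infty[M HM] := phi_near.
exists (M + 2)%N => N x hN h1 h2; rewrite -ltnNge in h1.
have NN : (N <= N ^ 2)%N by rewrite -mulnn; nia.
have := HM x; have -> : (M <= nsq x)%N by lia.
have := @pk_ln_bound R x; have -> : (4 <= nsq x)%N by rewrite -mulnn in h1; nia.
move=> /(_ isT) + /(_ isT).
have N0' : 0 < N%:R :> R by rewrite ltr0n; lia.
have n0 : 0 < (nsq x)%:R :> R by rewrite ltr0n (leq_trans _ h1).
have l1 : 2 * ln N%:R <= ln (nsq x)%:R :> R.
  by rewrite mulr_natl -lnXn// ler_ln ?posrE ?exprn_gt0// -natrX ler_nat ltnW.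
have l2 : ln (nsq x)%:R <= 2 * ln N%:R + ln 4 :> R.
  rewrite mulr_natl -lnXn// -lnM ?posrE ?exprn_gt0//.
  rewrite ler_ln ?posrE ?mulr_gt0 ?exprn_gt0// -natrX -natrM ler_nat.
  by apply: leq_trans h2 _; rewrite -!mulnn; nia.
have p0 := @pi_inv_gt0 R; have p1 := @pi_inv_le_half R; have := @ln4 R.
rewrite -!mulrA [pi^-1 * ln N%:R]mulrC mulrA.
move: (ln (nsq x)%:R) (ln N%:R) (ln 4) l1 l2 (pi^-1) p0 p1 => u v w l1 l2 p p0 p1.
have a1 : p * (2 * v) <= p * u by rewrite ler_wpM2l// ltW.
have a2 : p * u <= p * (2 * v + w) by rewrite ler_wpM2l// ltW.
move=> /andP[w0 w2].
have a3 : p * w <= 2^-1 * 2 by apply: ler_pM => //; exact: ltW.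
by rewrite !ler_distl; lra.
Qed.

(** The error is measured by F itself: on [s] every term vanishes, outside the disk F = 1, and all
    functions are harmonic in between, so the maximum principle applies for both signs. *)
Lemma escape_bound : exists M : nat, forall N w, (M <= N)%N -> disk N w ->
    `|L N * F N w - phi w| <= (B + 7) * F N w.
Proof.
have [M HM] := phi_boundary.
exists (M + N0)%N => N w hN dw.
have NN0 : (N0 <= N)%N by lia.
have NM : (M <= N)%N by lia.
have [t tP] := disk_seq (N ^ 2).+1.
pose D := [seq x <- t | x \notin s].
have gen (c : R) : `|c| = 1 -> c * (phi w - L N * F N w) - (B + 7) * F N w <= 0.
  move=> c1.
  have [ws|ws] := boolP (w \in s).
    by rewrite phi_on// F_on// !mulr0 subrr mulr0 subrr.
  have wD : w \in D by rewrite mem_filter ws tP ltnS.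
  apply: (@maximum_principle _
    (fun x => c * (phi x - L N * F N x) - (B + 7) * F N x) D) => //.
    move=> x; rewrite mem_filter tP ltnS => /andP[xs xN].
    rewrite avgB avgZ avgB !avgZ phi_harm// F_harm//.
  move=> x e; rewrite mem_filter tP ltnS => /andP[xs xN] es.
  rewrite mem_filter tP ltnS negb_and negbK => /orP[xes|xeN].
    by rewrite phi_on// F_on// !mulr0 subrr mulr0 subrr.
  rewrite F_out// !mulr1 subr_le0; apply: le_trans (ler_norm _) _.
  by rewrite normrM c1 mul1r; apply: HM => //; exact: nsq_step.
have := gen 1 (normr1 _); have := gen (-1) (normrN1 _).
by rewrite ler_distl; lra.
Qed.

Lemma escape_cvg w : ln (N%:R : R) * F N w @[N --> \oo] --> pi / 2 * phi w.
Proof.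
have [M HM] := escape_bound.
have p0 := @pi_gt0 R.
have Ly : L N @[N --> \oo] --> +oo.
  apply/cvgryPge => A; near=> N.
  rewrite mulrAC ler_pdivlMr// -ler_pdivrMl//.
  rewrite -[leLHS]expRK ler_ln ?posrE ?expR_gt0//; last first.
    by rewrite ltr0n; near: N; exact: nbhs_infty_gt.
  by near: N; exact: nbhs_infty_ger.
have sq (k : nat) : (k <= k ^ 2)%N by case: k => // k; rewrite -mulnn; nia.
suff H : L N * F N w @[N --> \oo] --> phi w.
  rewrite (_ : (fun N => _) = fun N => pi / 2 * (L N * F N w)).
    exact: cvgMr.
  have pn : pi != 0 :> R by rewrite gt_eqF.
  by apply/funext => N; rewrite !mulrA divfK ?mulfV ?mul1r.
apply/cvgrPdist_le => eps e0; near=> N.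
have dw : disk N w.
  apply: leq_trans (sq _); near: N; exact: nbhs_infty_ge.
have MN : (M <= N)%N by near: N; exact: nbhs_infty_ge.
have := HM N w MN dw; have := F_ge0 N w.
pose K := (B + 7) + 1 + (B + 7) ^+ 2.
have [B1 K0] : B + 7 <= K /\ 0 < K.
  have := sqr_ge0 (B + 7); have := sqr_ge0 (B + 7 + 2^-1).
  by rewrite /K !expr2; split; lra.
have L1 : 2 * K <= L N by near: N; move/cvgryPge: Ly; apply.
have L2 : 2 * K * (`|phi w| + 1) / eps <= L N by near: N; move/cvgryPge: Ly; apply.
rewrite ler_pdivrMr// in L2.
move: (L N) (F N w) L1 L2 => l f L1 L2 f0 hb.
have hb' : `|l * f - phi w| <= K * f by apply: le_trans hb _; rewrite ler_wpM2r.
(* As l >= 2K, the error K f is at most l f / 2 and is absorbed. Hence f is O(1/l), and the error K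
   f tends to 0. *)
have : l * f <= 2 * `|phi w|.
  have := ler_norm (phi w); move: hb'; rewrite ler_distl => /andP[h1 h2]; nra.
rewrite distrC => fl; apply: le_trans hb' _.
have l0 : 0 < l by nra.
rewrite -(ler_pM2l l0); have := normr_ge0 (phi w); nra.
Unshelve. all: by end_near. Qed.

End Escape.

(** * Reaching probabilities of the skeleton *)

Section Prob.
Context {R : realType} {d : measure_display} {T : measurableType d}.
Variables (P : Z2 -> probability T R) (x : Z2).
Implicit Types (A B E : set T).

Lemma probE A : measurable A -> P x A = (prob P x A)%:E.
Proof. by move=> mA; rewrite /prob fineK// fin_num_measure. Qed.

Lemma prob_ge0 A : 0 <= prob P x A.
Proof. exact: fine_ge0. Qed.

Lemma prob_le1 A : measurable A -> prob P x A <= 1.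
Proof. by move=> mA; rewrite -lee_fin -probE// probability_le1. Qed.

Lemma prob0 : prob P x set0 = 0.
Proof. by rewrite /prob measure0. Qed.

Lemma probDI A B : measurable A -> measurable B ->
  prob P x A = prob P x (A `\` B) + prob P x (A `&` B).
Proof.
move=> mA mB; apply/EFin_inj; rewrite EFinD -!probE//; last 2 first.
- exact: measurableI.
- exact: measurableD.
exact: measureDI.
Qed.

Lemma le_prob A B : measurable A -> measurable B -> A `<=` B ->
  prob P x A <= prob P x B.
Proof.
by move=> mA mB AB; rewrite -lee_fin -!probE// le_measure// inE.
Qed.

Lemma prob_null A B : measurable A -> measurable B -> prob P x B = 0 ->
  prob P x (A `\` B) = prob P x A.
Proof.
move=> mA mB B0; have z : prob P x (A `&` B) = 0.
  apply/eqP; rewrite eq_le prob_ge0 andbT -B0.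
  by apply: le_prob => //; exact: measurableI.
by rewrite [RHS](probDI mA mB) z addr0.
Qed.

Lemma prob_bigcup_cvg (E : nat -> set T) : (forall n, measurable (E n)) ->
  trivIset setT E ->
  \sum_(k < n) prob P x (E k) @[n --> \oo] --> prob P x (\bigcup_n E n).
Proof.
move=> mE tE; have mU : measurable (\bigcup_n E n) by exact: bigcup_measurable.
have : (\sum_(0 <= k < n) P x (E k))%E @[n --> \oo] --> P x (\bigcup_n E n).
  exact: (@measure_semi_sigma_additive _ _ _ (P x)).
rewrite (probE mU) => /fine_cvg; apply: cvg_trans; apply: near_eq_cvg.
apply: nearW => n; rewrite [LHS]/comp big_mkord.
rewrite (eq_bigr (fun k : 'I_n => (prob P x (E k))%:E)) ?sumEFin// => k _.
by rewrite probE.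
Qed.

End Prob.

Section Skeleton.
Context {R : realType} {d : measure_display} {T : measurableType d}.
Variables (P : Z2 -> probability T R) (Y : nat -> T -> Z2).
Implicit Types (v : nat -> Z2) (D G : set Z2).

Definition cylinder (n : nat) v : set T :=
  [set w | forall i, (i <= n)%N -> Y i w = v i].

Definition path_weight (n : nat) (x : Z2) v : R :=
  (v 0%N == x)%:R * \prod_(i < n) srw_kernel (v i) (v i.+1).

Hypothesis Y_meas : forall n (y : Z2), measurable (Y n @^-1` [set y]).
Hypothesis Y_law : forall x n v, prob P x (cylinder n v) = path_weight n x v.

Lemma cylinder_measurable n v : measurable (cylinder n v).
Proof.
rewrite (_ : cylinder n v = \bigcap_(i in `I_n.+1) (Y i @^-1` [set v i])).
  by apply: bigcap_measurable => //; exists 0%N.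
by apply/seteqP; split=> w /= h i; have := h i; rewrite /= ltnS.
Qed.

(** Finite tuples of sites are countable, so such an event is a countable union of cylinders. *)
Lemma measurable_dep (n : nat) (phi : (nat -> Z2) -> Prop) :
  (forall v v', (forall i, (i <= n)%N -> v i = v' i) -> phi v -> phi v') ->
  measurable [set w | phi (Y ^~ w)].
Proof.
move=> dep; pose N (t : n.+1.-tuple Z2) (i : nat) := nth 0 t i.
rewrite (_ : [set w | _] =
    \bigcup_t (if `[< phi (N t) >] then cylinder n (N t) else set0)).
  apply: countable_bigcupT_measurable; first exact: countableP.
  by move=> t; case: ifP => _; [exact: cylinder_measurable|exact: measurable0].
apply/seteqP; split=> [w /= phiw|w [t _]].
  pose t := [tuple of mkseq (Y ^~ w) n.+1].
  have tE i : (i <= n)%N -> Y i w = N t i.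
    by move=> ni; rewrite /N /= nth_mkseq.
  exists t => //; rewrite asboolT//; exact: dep phiw.
case: asboolP => //= phit cw; apply: dep phit => i ni; exact/esym/cw.
Qed.

Definition extend (n : nat) v (y : Z2) : nat -> Z2 :=
  fun i => if (i <= n)%N then v i else y.

Lemma cylinderS n v y :
  cylinder n.+1 (extend n v y) = cylinder n v `&` [set w | Y n.+1 w = y].
Proof.
apply/seteqP; split=> [w h|w [h1 h2] i].
  split=> [i ni|]; last by rewrite /= h// /extend ltnn.
  by rewrite h ?leqW// /extend ni.
rewrite leq_eqVlt ltnS /extend => /predU1P[->|ni]; first by rewrite ltnn.
by rewrite ni h1.
Qed.

Lemma path_weightS n x v e : e \in steps ->
  path_weight n.+1 x (extend n v (v n + e)) = path_weight n x v / 4.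
Proof.
move=> es; rewrite /path_weight big_ord_recr /= /extend leqnn ltnn leq0n.
rewrite {2}/srw_kernel addrAC subrr add0r es mul1r mulrA; congr (_ * _ / _).
by apply: eq_bigr => i _; rewrite ltnW// ltn_ord.
Qed.

Let Y_eq_meas n y : measurable [set w | Y n w = y].
Proof. exact: Y_meas. Qed.

Lemma prob_next_in x n (E : set T) (r : seq Z2) : measurable E -> uniq r ->
  prob P x (E `&` [set w | Y n w \in r]) =
  \sum_(y <- r) prob P x (E `&` [set w | Y n w = y]).
Proof.
move=> mE; elim: r => [_|y r IH /= /andP[yr ur]].
  rewrite big_nil (_ : _ `&` _ = set0) ?prob0//.
  by apply/seteqP; split=> // w [].
have mr (r' : seq Z2) : measurable [set w | Y n w \in r'].
  rewrite (_ : [set w | _] = \bigcup_(y in [set` r']) [set w | Y n w = y]).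
    by apply: fin_bigcup_measurable => // ? _; exact: Y_eq_meas.
  apply/seteqP; split=> [w /= h|w [y' /= + ->]//]; by exists (Y n w).
rewrite big_cons -(IH ur) addrC.
have mEr : measurable (E `&` [set w | Y n w \in y :: r]).
  by apply: measurableI => //; exact: mr.
rewrite (probDI P x mEr (Y_eq_meas n y)).
congr (_ + _); congr (prob P x _); apply/seteqP; split=> w /=.
- by rewrite inE => -[[Ew /orP[/eqP|]]].
- move=> [Ew yw]; split; first by split=> //; rewrite inE yw orbT.
  by move=> h; move: yr; rewrite -h yw.
- by move=> [[Ew _] h].
- by move=> [Ew h]; split=> //; split=> //; rewrite h mem_head.
Qed.

(** The weights of the four extensions by a step already add up to that of the cylinder, so the
    remaining part is null. *)
Lemma prob_cylinder_split x n v (E : set T) : measurable E ->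
  prob P x (cylinder n v `&` E) =
  \sum_(e <- steps) prob P x (cylinder n.+1 (extend n v (v n + e)) `&` E).
Proof.
move=> mE; pose r := [seq v n + e | e <- steps].
have ur : uniq r by rewrite map_inj_uniq//; exact: addrI.
have mC := cylinder_measurable n v.
pose S := [set w | Y n.+1 w \in r].
have mS : measurable S.
  by apply: (@measurable_dep n.+1 (fun v => v n.+1 \in r)) => u u' h; rewrite h.
have null : prob P x (cylinder n v `\` S) = 0.
  have := probDI P x mC mS; rewrite prob_next_in// big_map.
  under eq_big_seq => e es do rewrite -cylinderS Y_law path_weightS//.
  rewrite Y_law big_const_seq count_predT /= addr0.
  move: (path_weight _ _ _) => p; lra.
have mCE : measurable (cylinder n v `&` E) by exact: measurableI.
have mD : measurable (cylinder n v `\` S) by exact: measurableD.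
rewrite -(prob_null mCE mD null) (_ : _ `\` _ = (cylinder n v `&` E) `&` S).
  rewrite prob_next_in// big_map; apply: eq_bigr => e _.
  by rewrite cylinderS setIAC.
apply/seteqP; split=> w /=; last by move=> [[? ?] ?]; split=> // -[].
by move=> [[cw Ew] h]; split=> //; apply: contrapT => h'; apply: h.
Qed.

Definition indic D (x : Z2) : R := (`[< D x >])%:R.

(** Probability, from [x], of being in [D] at all times before n and in [G] at time n, built by
    conditioning on the first step. *)
Fixpoint stay_then D G (n : nat) (x : Z2) : R :=
  if n is m.+1 then indic D x * avg (stay_then D G m) x else indic G x.

Definition stay_event D G (k n : nat) : set T :=
  [set w | (forall i, (i < n)%N -> D (Y (k + i)%N w)) /\ G (Y (k + n)%N w)].

Lemma stay_event_measurable D G k n : measurable (stay_event D G k n).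
Proof.
apply: (@measurable_dep (k + n) (fun v =>
  (forall i, (i < n)%N -> D (v (k + i)%N)) /\ G (v (k + n)%N))).
move=> v v' h [h1 h2]; split=> [i ni|]; last by rewrite -h.
by rewrite -h; [exact: h1|rewrite leq_add2l ltnW].
Qed.

Lemma stay_eventS D G k n :
  stay_event D G k n.+1 = [set w | D (Y k w)] `&` stay_event D G k.+1 n.
Proof.
apply/seteqP; split=> [w [h1 h2]|w [h0 [h1 h2]]].
  split; first by have := h1 0%N isT; rewrite addn0.
  split=> [i ni|]; last by rewrite addSnnS.
  by rewrite addSnnS; exact: h1.
split=> [[_|i ni]|]; last by rewrite -addSnnS.
  by rewrite addn0.
by rewrite -addSnnS; exact: h1.
Qed.

Lemma cylinder_indic n v D (E : set T) x :
  prob P x (cylinder n v `&` ([set w | D (Y n w)] `&` E)) =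
  indic D (v n) * prob P x (cylinder n v `&` E).
Proof.
rewrite /indic; case: asboolP => Dv.
  rewrite mul1r; congr (prob P x _); apply/seteqP; split=> w [h1]; first by case.
  by move=> Ew; split=> //; split=> //=; rewrite h1.
rewrite mul0r (_ : _ `&` _ = set0) ?prob0//; apply/seteqP; split=> // w [h1 [/= h2 _]].
by apply: Dv; rewrite -h1.
Qed.

(** The Markov property at time k: given the path up to k, the future depends on [v k] alone. The
    induction needs [k] and [v] general, since each step lengthens the cylinder. *)
Lemma prob_stay_event D G k v x n :
  prob P x (cylinder k v `&` stay_event D G k.+1 n) =
  path_weight k x v * avg (stay_then D G n) (v k).
Proof.
elim: n k v => [|n IH] k v;
  rewrite (prob_cylinder_split _ _ _ (stay_event_measurable _ _ _ _)).
  have E0 : stay_event D G k.+1 0 = [set w | G (Y k.+1 w)] `&` setT.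
    apply/seteqP; split=> [w [_]|w [h _]]; first by rewrite addn0.
    by split=> //; rewrite addn0.
  rewrite E0 (eq_big_seq (fun e => path_weight k x v / 4 * indic G (v k + e))).
    by rewrite -mulr_sumr /avg mulrAC mulrA.
  by move=> e es; rewrite cylinder_indic setIT Y_law path_weightS// /extend ltnn mulrC.
rewrite stay_eventS (eq_big_seq (fun e => path_weight k x v / 4 *
    stay_then D G n.+1 (v k + e))).
  by rewrite -mulr_sumr /avg mulrAC mulrA.
move=> e es; rewrite cylinder_indic IH path_weightS// /extend ltnn /=.
by rewrite mulrCA.
Qed.

Lemma prob_start x (E : set T) : measurable E ->
  prob P x E = prob P x (cylinder 0 (fun=> x) `&` E).
Proof.
move=> mE; have mC := cylinder_measurable 0 (fun=> x).
have mCc : measurable (~` cylinder 0 (fun=> x)) by exact: measurableC.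
rewrite -(prob_null mE mCc); first by rewrite setDE setCK setIC.
have := probDI P x measurableT mC.
rewrite setTI setTD Y_law /path_weight eqxx big_ord0 mulr1.
by rewrite {1}/prob probability_setT /=; lra.
Qed.

Lemma prob_stay_event0 D G x n :
  prob P x (stay_event D G 0 n) = stay_then D G n x.
Proof.
rewrite prob_start; last exact: stay_event_measurable.
have pw : path_weight 0 x (fun=> x) = 1.
  by rewrite /path_weight eqxx big_ord0 mulr1.
case: n => [|n].
  rewrite (_ : stay_event D G 0 0 = [set w | G (Y 0 w)] `&` setT).
    by rewrite cylinder_indic setIT Y_law pw mulr1.
  by apply/seteqP; split=> [w [_]|w [h _]].
by rewrite stay_eventS cylinder_indic prob_stay_event pw mul1r.
Qed.

Lemma prob_stay_event1 D G x n :
  prob P x (stay_event D G 1 n) = avg (stay_then D G n) x.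
Proof.
rewrite prob_start; last exact: stay_event_measurable.
rewrite prob_stay_event /path_weight eqxx big_ord0 mulr1 mul1r.
by [].
Qed.

Definition reach_event D G (k : nat) : set T :=
  [set w | exists n, (forall i, (i < n)%N -> D (Y (k + i)%N w)) /\ G (Y (k + n)%N w)].

Definition reach_prob D G (x : Z2) : R := prob P x (reach_event D G 0).

Lemma reach_eventE D G k : reach_event D G k = \bigcup_n stay_event D G k n.
Proof. by apply/seteqP; split=> [w [n h]|w [n _ h]]; exists n. Qed.

Lemma reach_event_measurable D G k : measurable (reach_event D G k).
Proof.
by rewrite reach_eventE; apply: bigcup_measurable => n _; exact: stay_event_measurable.
Qed.

Lemma stay_event_triv D G k : D `&` G = set0 -> trivIset setT (stay_event D G k).
Proof.
move=> DG; apply/trivIsetP => m n _ _.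
wlog mn : m n / (m < n)%N.
  move=> H; rewrite neq_ltn => /orP[mn|nm]; first by apply: H => //; rewrite ltn_eqF.
  by rewrite setIC; apply: H => //; rewrite ltn_eqF.
move=> _; apply/seteqP; split=> // w [[_ Gm] [Dn _]].
have : (D `&` G) (Y (k + m)%N w) by split=> //; exact: Dn.
by rewrite DG.
Qed.

(** Disjointness of [D] and [G] makes the time of reaching [G] unique, so both sides are sums over
    that time, and the finite average commutes with the limit. *)
Lemma reach_prob1 D G x : D `&` G = set0 ->
  prob P x (reach_event D G 1) = avg (reach_prob D G) x.
Proof.
move=> DG.
have h0 y : \sum_(k < n) stay_then D G k y @[n --> \oo] --> reach_prob D G y.
  rewrite /reach_prob reach_eventE.
  under eq_cvg => n do under eq_bigr => k _ do rewrite -prob_stay_event0.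
  apply: prob_bigcup_cvg; [exact: stay_event_measurable|exact: stay_event_triv].
have h1 : \sum_(k < n) prob P x (stay_event D G 1 k) @[n --> \oo] -->
    prob P x (reach_event D G 1).
  rewrite reach_eventE.
  by apply: prob_bigcup_cvg; [exact: stay_event_measurable|exact: stay_event_triv].
have h2 : \sum_(k < n) prob P x (stay_event D G 1 k) @[n --> \oo] -->
    avg (reach_prob D G) x.
  rewrite (_ : (fun n => _) = fun n => avg (fun y => \sum_(k < n) stay_then D G k y) x).
    by apply: avg_cvg => e _; exact: h0.
  apply/funext => n; rewrite avg_sum; apply: eq_bigr => k _; exact: prob_stay_event1.
by rewrite -(cvg_lim _ h1)// (cvg_lim _ h2).
Qed.

Lemma reach_prob_on D G x : G x -> reach_prob D G x = 1.
Proof.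
move=> Gx; rewrite /reach_prob prob_start; last exact: reach_event_measurable.
rewrite (_ : _ `&` _ = cylinder 0 (fun=> x)).
  by rewrite Y_law /path_weight eqxx big_ord0 mulr1.
apply/seteqP; split=> [w []//|w h]; split=> //; exists 0%N; split=> //.
by rewrite (h 0%N).
Qed.

Lemma reach_prob_off D G x : ~ G x -> ~ D x -> reach_prob D G x = 0.
Proof.
move=> Gx Dx; rewrite /reach_prob prob_start; last exact: reach_event_measurable.
rewrite (_ : _ `&` _ = set0) ?prob0//; apply/seteqP; split=> // w [h [[|n] [h1 h2]]].
  by apply: Gx; rewrite -(h 0%N).
by apply: Dx; rewrite -(h 0%N)//; exact: (h1 0%N).
Qed.

Lemma reach_prob_harmonic D G x : D `&` G = set0 -> D x ->
  avg (reach_prob D G) x = reach_prob D G x.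
Proof.
move=> DG Dx; rewrite -reach_prob1// /reach_prob.
rewrite prob_start; last exact: reach_event_measurable.
rewrite [RHS]prob_start; last exact: reach_event_measurable.
congr (prob P x _); apply/seteqP; split=> w [h [n [h1 h2]]]; split=> //.
  by exists n.+1; split=> // -[_|i ni]; [rewrite (h 0%N)|exact: h1].
case: n h1 h2 => [|n] h1 h2; last by exists n; split=> // i ni; exact: (h1 i.+1).
have : (D `&` G) x by split=> //; rewrite -(h 0%N).
by rewrite DG.
Qed.

Lemma reach_prob_bound D G x : 0 <= reach_prob D G x <= 1.
Proof. by rewrite prob_ge0 prob_le1//; exact: reach_event_measurable. Qed.

(** 0 is not a step. Hence almost surely [first_jump], defined by a change of position, is the end
    of the first holding time. *)
Lemma prob_first_step x :
  prob P x [set w | Y 0 w = x /\ Y 1 w <> x] = 1.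
Proof.
have mA : measurable [set w | Y 1 w <> x].
  by apply: (@measurable_dep 1 (fun v => v 1%N <> x)) => u u' h; rewrite h.
transitivity (prob P x (stay_event setT [set y | y <> x] 1 0)).
  rewrite [RHS]prob_start; last exact: stay_event_measurable.
  congr (prob P x _); apply/seteqP; split=> [w [h1 h2]|w [h1 [_ h2]]].
    by split=> // i; rewrite leqn0 => /eqP ->.
  by split=> //; exact: (h1 0%N).
rewrite prob_stay_event1 -[RHS](avg_cst 1 x); apply: eq_avg => e es.
rewrite /= /indic asboolT// => /eqP; rewrite -subr_eq0 addrAC subrr add0r.
by move: es => /steps_cases[] ->.
Qed.

End Skeleton.

(** * Hitting times of step paths *)

Section StepPath.
Context {R : realType}.
Variables (p : R -> Z2) (y : nat -> Z2) (J : nat -> R).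
Hypothesis J0 : J 0 = 0.
Hypothesis J_incr : forall n, J n < J n.+1.
Hypothesis Jy : J n @[n --> \oo] --> +oo.
Hypothesis pJ : forall n t, J n <= t < J n.+1 -> p t = y n.
Implicit Types (A B : set Z2) (a b : nat -> Prop).

Lemma J_lt (i j : nat) : (i < j)%N -> J i < J j.
Proof.
elim: j => // j IH; rewrite ltnS leq_eqVlt => /predU1P[->//|/IH/lt_trans]; exact.
Qed.

Lemma J_le (i j : nat) : (i <= j)%N -> J i <= J j.
Proof. by rewrite leq_eqVlt => /predU1P[->//|/J_lt/ltW]. Qed.

Lemma J_ltn (i j : nat) (t : R) : J i <= t -> t < J j -> (i < j)%N.
Proof.
move=> it tj; rewrite ltnNge; apply/negP => /J_le.
by rewrite leNgt (le_lt_trans it tj).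
Qed.

Lemma pJn (n : nat) : p (J n) = y n.
Proof. by apply: pJ; rewrite lexx J_incr. Qed.

Lemma p0 : p 0 = y 0.
Proof. by rewrite -J0 pJn. Qed.

Lemma J_locate (t : R) : 0 <= t -> exists n, J n <= t < J n.+1.
Proof.
move=> t0; have [m tm] : exists m, t < J m.
  have /cvgryPge /(_ (t + 1)) [m _ Hm] := Jy.
  by exists m; apply: lt_le_trans (Hm m (leqnn _)); rewrite ltrDl.
elim: m tm => [|m IH tm]; first by rewrite J0 ltNge t0.
by have [tm'|tm'] := ltP t (J m); [exact: IH|exists m; rewrite tm' tm].
Qed.

(** Records that tau is the jump time of the first index satisfying [a], or +oo if there is none, so
    that comparing random times becomes comparing indices. *)
Definition first_time a (tau : \bar R) : Prop :=
  (forall n, a n -> (forall i, (i < n)%N -> ~ a i) -> tau = (J n)%:E) /\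
  ((forall n, ~ a n) -> tau = +oo%E).

Lemma first_index a : (exists n, a n) ->
  exists n, a n /\ forall i, (i < n)%N -> ~ a i.
Proof.
move=> [n an]; have ex : exists n, `[< a n >] by exists n; exact/asboolP.
case: (ex_minnP ex) => m /asboolP am mmin; exists m; split=> // i im ai.
by have := mmin i (asboolT ai); rewrite leqNgt im.
Qed.

Lemma first_timeP a tau : first_time a tau ->
  (exists n, [/\ a n, (forall i, (i < n)%N -> ~ a i) & tau = (J n)%:E]) \/
  ((forall n, ~ a n) /\ tau = +oo%E).
Proof.
move=> [h1 h2]; have [ex|nex] := pselect (exists n, a n).
  by left; have [n [an amin]] := first_index ex; exists n; split=> //; exact: h1.
have no n : ~ a n by move=> an; apply: nex; exists n.
by right; split=> //; exact: h2.
Qed.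

Lemma first_time_gt a tau n : first_time a tau ->
  ((J n)%:E < tau)%E <-> forall i, (i <= n)%N -> ~ a i.
Proof.
move=> /first_timeP[[m [am mmin ->]]|[no ->]]; last by split=> // _; rewrite ltry.
rewrite lte_fin; split=> [nm i ni|h].
  by apply: mmin; apply: leq_ltn_trans ni (J_ltn (lexx _) nm).
by apply: J_lt; rewrite ltnNge; apply/negP => /h.
Qed.

Lemma first_time_lt a b tau sigma : first_time a tau -> first_time b sigma ->
  (tau < sigma)%E <-> exists n, [/\ a n, (forall i, (i < n)%N -> ~ a i) &
                                 forall i, (i <= n)%N -> ~ b i].
Proof.
move=> fa fb; split=> [|[n [an amin nb]]].
  have [[n [an amin ->]]|[_ ->]] := first_timeP fa; last by rewrite ltNge leey.
  by move=> /(first_time_gt _ fb) nb; exists n.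
by rewrite (fa.1 n an amin); apply/(first_time_gt _ fb).
Qed.

Lemma first_time_at a tau x : first_time a tau ->
  ((tau < +oo)%E /\ p (fine tau) = x) <->
  exists n, [/\ a n, (forall i, (i < n)%N -> ~ a i) & y n = x].
Proof.
move=> fa; split=> [[tf px]|[n [an amin yx]]].
  have [[n [an amin te]]|[_ te]] := first_timeP fa; last by rewrite te in tf.
  by exists n; split=> //; rewrite -px te /= pJn.
by rewrite (fa.1 n an amin) ltry /= pJn.
Qed.

(** The path equals [y n] on [J n, J (n+1)), closed on the left, so the infimum is attained at a
    jump time. *)
Lemma first_time_entrance A (c : nat) :
  first_time (fun n => (c <= n)%N /\ A (y n)) (entrance_after (J c)%:E A p).
Proof.
have memP t : ((J c)%:E <= t%:E)%E -> A (p t) ->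
    exists2 n, (c <= n)%N /\ A (y n) & J n <= t.
  rewrite lee_fin => ct At.
  have t0 : 0 <= t by apply: le_trans ct; rewrite -J0 J_le.
  have [n /andP[nt tn]] := J_locate t0; exists n => //.
  by split; [rewrite -ltnS; exact: J_ltn ct tn|rewrite -(@pJ n t)// nt tn].
split=> [n [cn An] nmin|no].
  apply/eqP; rewrite eq_le; apply/andP; split.
    apply: ereal_inf_lbound; exists (J n) => //=; split; first by rewrite lee_fin J_le.
    by rewrite pJn.
  apply/ereal_infP => _ [t [/= ct At] <-]; rewrite lee_fin.
  have [m mA mt] := memP t ct At; apply: le_trans mt; apply: J_le.
  by rewrite leqNgt; apply/negP => /nmin; exact.
rewrite /entrance_after (_ : [set t%:E | t in _] = set0) ?ereal_inf0//.
apply/seteqP; split=> // _ [t [/= ct At] _].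
by have [m mA _] := memP t ct At; exact: no mA.
Qed.

Lemma first_time_hit A : first_time (fun n => A (y n)) (hit A p).
Proof.
have := first_time_entrance A 0; rewrite J0 => -[h1 h2]; split=> [n An nmin|no].
  by apply: h1 => // i im [_]; exact: nmin.
by apply: h2 => n [_]; exact: no.
Qed.

Lemma first_jumpE : first_jump p = hit [set v | v <> y 0] p.
Proof.
by rewrite /first_jump /hit /entrance_after p0; congr ereal_inf; congr image.
Qed.

Lemma first_time_return A :
  first_time (fun n => (exists2 j, (j <= n)%N & y j <> y 0) /\ A (y n))
             (hit_return A p).
Proof.
rewrite /hit_return first_jumpE.
have [[m [ym mmin ->]]|[no ->]] := first_timeP (first_time_hit [set v | v <> y 0]).
  have [h1 h2] := first_time_entrance A m.
  have jumped n : (exists2 j, (j <= n)%N & y j <> y 0) <-> (m <= n)%N.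
    split=> [[j jn yj]|mn]; last by exists m.
    by apply: leq_trans jn; rewrite leqNgt; apply/negP => /mmin; exact.
  split=> [n [/jumped mn An] nmin|none].
    by apply: h1 => // i im [mi Ai]; apply: (nmin i im); split=> //; exact/jumped.
  by apply: h2 => n [mn An]; apply: (none n); split=> //; exact/jumped.
(* If the path never moves, the first jump time is +oo and no real time lies beyond it. *)
split=> [n [[j _ yj]]|_]; first by have := no j yj.
rewrite /entrance_after (_ : [set t%:E | t in _] = set0) ?ereal_inf0//.
by apply/seteqP; split=> // _ [t [/= h _] _]; move: h; rewrite leye_eq.
Qed.

End StepPath.

(** * The continuous-time walk *)

Section Events.
Context {R : realType} {d : measure_display} {T : measurableType d}.
Variables (X : T -> R -> Z2) (P : Z2 -> probability T R).
Variables (Y : nat -> T -> Z2) (J : T -> nat -> R).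
Implicit Types (A B D G : set Z2) (s : seq Z2).
Hypothesis Y_meas : forall n (y : Z2), measurable (Y n @^-1` [set y]).
Hypothesis Y_law : forall x n v,
  prob P x (cylinder Y n v) = path_weight n x v.
Hypothesis J0 : forall w, J w 0 = 0.
Hypothesis J_incr : forall w n, J w n < J w n.+1.
Hypothesis Jy : forall w, J w n @[n --> \oo] --> +oo.
Hypothesis XJ : forall w n t, J w n <= t < J w n.+1 -> X w t = Y n w.

Lemma hit_first w A :
  first_time (J w) (fun n => A (Y n w)) (hit A (X w)).
Proof. exact: (first_time_hit (J0 w) (J_incr w) (@Jy w) (@XJ w)). Qed.

Lemma exit_first w A :
  first_time (J w) (fun n => ~ A (Y n w)) (exit A (X w)).
Proof. exact: hit_first. Qed.

Lemma return_first w A : first_time (J w)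
  (fun n => (exists2 j, (j <= n)%N & Y j w <> Y 0 w) /\ A (Y n w))
  (hit_return A (X w)).
Proof. exact: (first_time_return (J0 w) (J_incr w) (@Jy w) (@XJ w)). Qed.

Lemma exit_before_hit A B : A `<=` B ->
  [set w | (exit B (X w) < hit A (X w))%E] = reach_event Y (B `\` A) (~` B) 0.
Proof.
move=> AB; apply/seteqP; split=> w /=.
  move=> /(first_time_lt (J_incr w) (exit_first w B) (hit_first w A)).
  move=> [n [Bn h1 h2]]; exists n; split=> // i ni; split.
    by apply: contrapT; exact: h1.
  by apply: h2; exact: ltnW.
move=> [n [h1 h2]].
apply/(first_time_lt (J_incr w) (exit_first w B) (hit_first w A)).
exists n; split=> // i; first by move=> /h1[Bi _]; exact.
(* At the exit index itself the walk is off [B], hence off [A]. *)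
by rewrite leq_eqVlt => /predU1P[->|/h1[]//]; move=> /AB.
Qed.

Lemma measurable_dep_seq (phi : nat -> (nat -> Z2) -> Prop) :
  (forall n v v', (forall i, (i <= n)%N -> v i = v' i) -> phi n v -> phi n v') ->
  measurable [set w | exists n, phi n (Y ^~ w)].
Proof.
move=> dep; rewrite (_ : [set w | _] = \bigcup_n [set w | phi n (Y ^~ w)]).
  by apply: bigcup_measurable => n _; exact: (measurable_dep Y_meas (dep n)).
by apply/seteqP; split=> [w [n h]|w [n _ h]]; exists n.
Qed.

Lemma prob_as x (E E' S : set T) : measurable E -> measurable E' -> measurable S ->
  prob P x S = 1 -> (forall w, S w -> E w <-> E' w) -> prob P x E = prob P x E'.
Proof.
move=> mE mE' mS S1 EE'; have mSc : measurable (~` S) by exact: measurableC.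
have null : prob P x (~` S) = 0.
  have := probDI P x measurableT mS; rewrite setTI setTD S1.
  by rewrite {1}/prob probability_setT /=; lra.
rewrite -(prob_null mE mSc null) -(prob_null mE' mSc null); congr (prob P x _).
by apply/seteqP; split=> w [Ew /contrapT Sw]; split=> //; exact/(EE' w Sw).
Qed.

Lemma jumped_dep n (v v' : nat -> Z2) i : (forall i, (i <= n)%N -> v i = v' i) ->
  (i <= n)%N -> (exists2 j, (j <= i)%N & v j <> v 0%N) ->
  exists2 j, (j <= i)%N & v' j <> v' 0%N.
Proof.
by move=> vv' ni [j ji vj]; exists j => //; rewrite -!vv'// (leq_trans ji).
Qed.

Lemma prob_exit_before_return x A B : A `<=` B -> A x ->
  prob P x [set w | (exit B (X w) < hit_return A (X w))%E] =
  avg (reach_prob P Y (B `\` A) (~` B)) x.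
Proof.
move=> AB Ax; rewrite -(reach_prob1 Y_meas Y_law); last first.
  by apply/seteqP; split=> // ? [[]].
(* Paths with [Y 1 = Y 0] form a null set, but the event has to be described
   on them too, for its measurability. *)
pose phi n (v : nat -> Z2) := [/\ ~ B (v n), (forall i, (i < n)%N -> ~ ~ B (v i)) &
  forall i, (i <= n)%N -> ~ ((exists2 j, (j <= i)%N & v j <> v 0%N) /\ A (v i))].
have E w : (exit B (X w) < hit_return A (X w))%E <-> exists n, phi n (Y ^~ w).
  exact: (first_time_lt (J_incr w) (exit_first w B) (return_first w A)).
apply: (@prob_as _ _ _ [set w | Y 0 w = x /\ Y 1 w <> x]).
- rewrite (_ : [set w | _] = [set w | exists n, phi n (Y ^~ w)]).
    apply: measurable_dep_seq => n v v' vv' [h1 h2 h3]; split.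
    + by rewrite -vv'.
    + by move=> i ni; rewrite -vv' ?(ltnW ni)//; exact: h2.
    + move=> i ni [ji Ai]; apply: (h3 i ni); split; last by rewrite vv'.
      by apply: (@jumped_dep n v' v i) => // k kn; rewrite vv'.
  by apply/seteqP; split=> w /= /E.
- exact: reach_event_measurable.
- apply: (measurable_dep Y_meas (n := 1) (phi := fun v => v 0%N = x /\ v 1%N <> x)).
  by move=> v v' h; rewrite !h.
- exact: prob_first_step.
move=> w [Y0 Y1] /=; rewrite E; split=> [[n [h1 h2 h3]]|[n [h1 h2]]].
  have jumped i : (0 < i)%N -> exists2 j, (j <= i)%N & Y j w <> Y 0 w.
    by exists 1%N; rewrite ?Y0.
  (* The start lies in [B], so the exit index is positive, and it shifts by one when counted from
     time 1. *)
  case: n h1 h2 h3 => [|n] h1 h2 h3; first by case: h1; rewrite Y0; exact: AB.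
  exists n; split=> // i ni; split; first by apply: contrapT; exact: (h2 i.+1).
  by move=> Ai; apply: (h3 i.+1 (ltnW ni)); exact: conj (jumped i.+1 isT) Ai.
exists n.+1; split=> // i.
  case: i => [_|i ni]; first by rewrite Y0 => h; apply/h/AB.
  by have [Bi _] := h1 i ni; exact.
case: i => [_ [[j]]|i]; first by rewrite leqn0 => /eqP ->.
rewrite ltnS leq_eqVlt => /predU1P[->|ni] [_ Ai]; first by apply: h2; exact: AB.
by have [_] := h1 i ni; exact.
Qed.

(** From a start off [A], any visit to [A] is preceded or accompanied by a change of position, so
    the return time is the hitting time. *)
Lemma prob_hit_at x z A : A x -> ~ A z ->
  prob P z [set w | (hit_return A (X w) < +oo)%E /\
                    X w (fine (hit_return A (X w))) = x] =
  reach_prob P Y (~` A) [set x] z.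
Proof.
move=> Ax Az.
pose phi n (v : nat -> Z2) :=
  [/\ (exists2 j, (j <= n)%N & v j <> v 0%N) /\ A (v n),
      (forall i, (i < n)%N -> ~ ((exists2 j, (j <= i)%N & v j <> v 0%N) /\ A (v i))) &
      v n = x].
have E w : ((hit_return A (X w) < +oo)%E /\ X w (fine (hit_return A (X w))) = x) <->
    exists n, phi n (Y ^~ w).
  exact: (first_time_at (J_incr w) (@XJ w) x (return_first w A)).
apply: (@prob_as _ _ _ (cylinder Y 0 (fun=> z))).
- rewrite (_ : [set w | _] = [set w | exists n, phi n (Y ^~ w)]).
    apply: measurable_dep_seq => n v v' vv' [[h1 h1'] h2 h3]; split.
    + by split; [exact: (@jumped_dep n v v' n)|rewrite -vv'].
    + move=> i ni [ji Ai]; apply: (h2 i ni); split; last by rewrite vv' ?(ltnW ni).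
      by apply: (@jumped_dep n v' v i) => // [k kn|]; [rewrite vv'|exact: ltnW].
    + by rewrite -vv'.
  by apply/seteqP; split=> w /= /E.
- exact: reach_event_measurable.
- exact: cylinder_measurable.
- by rewrite Y_law /path_weight eqxx big_ord0 mulr1.
move=> w Y0 /=; rewrite E.
have jumped i : A (Y i w) -> exists2 j, (j <= i)%N & Y j w <> Y 0 w.
  by move=> Ai; exists i => // Yi; apply: Az; rewrite -(Y0 0%N)// -Yi.
split=> [[n [_ h2 h3]]|[n [h1 h2]]].
  by exists n; split=> // i ni Ai; apply: (h2 i ni); split=> //; exact: jumped.
exists n; split=> //.
  have An : A (Y n w) by rewrite (h2 : Y n w = x).
  by split=> //; exact: jumped.
by move=> i ni [_]; exact: h1.
Qed.

Lemma ball2E (N : nat) x : ball2 (R := R) N x <-> (nsq x <= N ^ 2)%N.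
Proof. by rewrite /ball2 /= enorm_le. Qed.

Lemma seq_sub_ball s : exists N0 : nat, forall N, (N0 <= N)%N ->
  [set` s] `<=` ball2 (R := R) N.
Proof.
suff [N0 H] : exists N0 : nat, forall x, x \in s -> (nsq x <= N0)%N.
  exists N0 => N hN x /H hx; apply/ball2E; apply: (leq_trans hx).
  by apply: leq_trans hN _; rewrite -mulnn; nia.
elim: s => [|u s [N0 H]]; first by exists 0%N.
exists (maxn N0 (nsq u)) => x; rewrite inE => /predU1P[->|/H]; first exact: leq_maxr.
by move=> /leq_trans; apply; exact: leq_maxl.
Qed.

Lemma reach_escape_cvg s (phi : Z2 -> R) (B : R) w :
  (forall x, x \in s -> phi x = 0) ->
  (forall x, x \notin s -> avg phi x = phi x) ->
  (\forall x \near at_infty (R := R), `|phi x - 1 * potential_kernel x| <= B) ->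
  ln (N%:R : R) * reach_prob P Y (ball2 (R := R) N `\` [set` s]) (~` ball2 (R := R) N) w
    @[N --> \oo] --> pi / 2 * phi w.
Proof.
move=> phi_on phi_harm phi_near; have [N0 HN0] := seq_sub_ball s.
apply: (escape_cvg (N0 := N0) phi_on phi_harm phi_near
  (F := fun N => reach_prob P Y (ball2 (R := R) N `\` [set` s]) (~` ball2 (R := R) N))).
- move=> N x hN xs; apply: (reach_prob_off Y_meas Y_law); last by case.
  by move=> h; apply: h; exact: HN0 hN _ xs.
- by move=> N x hN /negP xN; apply: (reach_prob_on Y_meas Y_law) => /ball2E.
- move=> N x hN xN xs; apply: (reach_prob_harmonic Y_meas Y_law).
    by apply/seteqP; split=> // ? [[]].
  by split; [exact/ball2E|exact/negP].
- by move=> N x; have /andP[] := @reach_prob_bound _ _ _ P Y Y_meas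
    (ball2 (R := R) N `\` [set` s]) (~` ball2 (R := R) N) x.
Qed.

Section Capacity.
Variables (s : seq Z2).
Hypothesis s_uniq : uniq s.

Let h (x w : Z2) : R := reach_prob P Y (~` [set` s]) [set x] w.

Let h_on x w : x \in s -> w \in s -> h x w = (w == x)%:R.
Proof.
move=> xs ws; have [->|wx] := eqVneq w x.
  by apply: (reach_prob_on Y_meas Y_law).
by apply: (reach_prob_off Y_meas Y_law) => [/eqP|]; [exact/negP|exact].
Qed.

Let h_harm x w : x \in s -> w \notin s -> avg (h x) w = h x w.
Proof.
move=> xs ws; apply: (reach_prob_harmonic Y_meas Y_law); last exact/negP.
by apply/seteqP; split=> // u [+ ux]; rewrite ux; exact.
Qed.

Let h_bound x w : 0 <= h x w <= 1.
Proof. exact: reach_prob_bound. Qed.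

(** The three descriptions of one measure mu = [avg green]: harmonic measure, measure of constant
    potential on [s], and rescaled limit of the equilibrium measures. [C] is the capacity. *)
Lemma equilibrium_potential z : z \in s -> exists mu : Z2 -> R, exists C : R,
  [/\ forall x, x \in s -> harmonic_measure X P [set` s] x = mu x,
      forall y, y \in s -> \sum_(x <- s) potential_kernel (x - y) * mu x = C &
      forall x, x \in s ->
        ln (N%:R : R) * equilibrium X P [set` s] N x @[N --> \oo] --> pi / 2 * mu x].
Proof.
move=> zs; pose g := green s h z.
have [_ [C HC]] := green_equilibrium s_uniq h_on h_harm h_bound zs.
exists (avg g), C; split.
- move=> x xs; apply: cvg_lim => //.
  apply: cvg_trans (hitting_cvg s_uniq h_on h_harm h_bound zs xs).
  apply: near_eq_cvg; apply/near_at_infty.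
  have [N0 /(_ N0 (leqnn _)) HN0] := seq_sub_ball s.
  exists (N0 ^ 2).+1 => w hw; apply/esym/prob_hit_at => //.
  by move=> /HN0 /ball2E; rewrite leqNgt hw.
- move=> y ys; rewrite -(HC y ys); apply: eq_bigr => x _.
  by rewrite mulrC -(opprB y x) pkN.
- move=> x xs; have [N0 HN0] := seq_sub_ball s.
  have [B HB] := green_near s z h_bound.
  have FF w := @reach_escape_cvg s g B w (@green_on _ _ _ z s_uniq h_on)
    (green_harmonic h_harm zs) HB.
  have : avg (fun y => ln (N%:R : R) * reach_prob P Y
        (ball2 (R := R) N `\` [set` s]) (~` ball2 (R := R) N) y) x
      @[N --> \oo] --> avg (fun y => pi / 2 * g y) x.
    by apply: avg_cvg => e _; exact: FF.
  rewrite avgZ; apply: cvg_trans; apply: near_eq_cvg; near=> N.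
  (* From a site of [s], escaping before returning means one step and then escaping before
     hitting. *)
  rewrite avgZ; congr (_ * _).
  have hN : (N0 <= N)%N by near: N; exact: nbhs_infty_ge.
  by rewrite /equilibrium prob_exit_before_return ?indicE ?mem_set ?mulr1//; exact: HN0.
Unshelve. all: by end_near. Qed.

End Capacity.

End Events.

Theorem lemma2p1 (R : realType) (d : measure_display) (T : measurableType d)
    (X : T -> R -> Z2) (P : Z2 -> probability T R) (hX : is_ctsrw X P)
    (A : set Z2) (Afin : finite_set A) (A0 : A !=set0)
    (y : Z2) (Ay : A y) (z : Z2) (Az : A z) :
  let u := fun N : nat =>
    ln (N%:R : R) ^+ 2 *
    \sum_(x \in A)
      equilibrium X P A N x *
      prob P x [set w | (exit (ball2 (R := R) N) (X w)
                         < hit [set y] (X w))%E] in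
  cvgn u /\ capacity X P A z = 4 / pi ^+ 2 * limn u.
Proof.
move=> u.
have [Y [sigma [[Y_meas _] s_gt0 Jy XJ law]]] := hX.
pose J w n := jump_time sigma n w.
have Y_law x n v : prob P x (cylinder Y n v) = path_weight n x v.
  have := law x n v (fun=> setT) (fun=> measurableT).
  (* Leaving the holding times unconstrained gives exponential factors of total mass 1, and the law
     of the skeleton remains. *)
  rewrite [X in (_ * X)%E]big1 ?mule1; last first.
    by move=> i _; exact: integral_exponential_pdf.
  rewrite (_ : [set w | _] = cylinder Y n v) /prob; first by move=> ->.
  by apply/seteqP; split=> w hw i /hw // [].
have J0 w : J w 0 = 0 by rewrite /J /jump_time big_ord0.
have J_incr w n : J w n < J w n.+1 by rewrite /J /jump_time big_ord_recr ltrDl.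
have XJ' w n t : J w n <= t < J w n.+1 -> X w t = Y n w by exact: XJ.
have [s0 A0E] := (finite_seqP A).1 Afin.
pose s := undup s0; have s_uniq : uniq s by exact: undup_uniq.
have AE : A = [set` s] by rewrite A0E; apply/seteqP; split=> x /=; rewrite mem_undup.
have ms x : A x -> x \in s by rewrite AE.
have [mu [C [hm pot eqm]]] := equilibrium_potential Y_meas Y_law J0 J_incr Jy XJ'
  s_uniq (ms z Az).
have esc x : ln (N%:R : R) *
    prob P x [set w | (exit (ball2 (R := R) N) (X w) < hit [set y] (X w))%E]
    @[N --> \oo] --> pi / 2 * potential_kernel (x - y).
  have [B HB] := @pk_shift_bounded R y.
  have sE : [set` [:: y]] = [set y].
    by apply/seteqP; split=> v /=; rewrite inE => /eqP.
  have := @reach_escape_cvg _ _ _ P Y Y_meas Y_law [:: y]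
    (fun w => potential_kernel (w - y)) B x.
  have h1 v : v \in [:: y] -> potential_kernel (v - y) = 0 :> R.
    by rewrite inE => /eqP ->; rewrite subrr pk0.
  have h2 v : v \notin [:: y] ->
      avg (fun w => potential_kernel (w - y)) v = potential_kernel (v - y) :> R.
    by rewrite inE => /negbTE vy; rewrite avg_pk_shift vy addr0.
  have h3 : \forall w \near at_infty (R := R),
      `|potential_kernel (w - y) - 1 * potential_kernel w| <= B.
    by apply: filterS HB => w; rewrite mul1r.
  move=> /(_ h1 h2 h3); apply: cvg_trans; apply: near_eq_cvg.
  have [N0 HN0] := @seq_sub_ball R [:: y].
  near=> N; congr (_ * _); rewrite /reach_prob sE.
  rewrite (exit_before_hit J0 J_incr Jy XJ')// -sE; apply: HN0.
  by near: N; exact: nbhs_infty_ge.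
(* One logarithm goes to the equilibrium measure and one to the escape from [y]; the finite sum then
   converges term by term to a multiple of the potential of mu at [y]. *)
have ucvg : u @ \oo --> (pi / 2) ^+ 2 * C.
  rewrite -(pot y (ms y Ay)) mulr_sumr.
  rewrite (_ : u = fun N => \sum_(x <- s) (ln (N%:R : R) * equilibrium X P A N x) *
    (ln (N%:R : R) * prob P x [set w | (exit (ball2 (R := R) N) (X w)
                         < hit [set y] (X w))%E])).
    rewrite [X in _ --> X](eq_big_seq (fun x => (pi / 2 * mu x) *
      (pi / 2 * potential_kernel (x - y)))); last by move=> x _; ring.
    by apply: cvg_sum_seq => x xs; apply: cvgM; [rewrite AE; exact: eqm|exact: esc].
  apply/funext => N; rewrite /u AE -fsbig_seq// mulr_sumr.
  by apply: eq_bigr => x _; ring.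
split; first exact: cvgP ucvg.
rewrite (cvg_lim _ ucvg)// /capacity AE -fsbig_seq//.
rewrite (eq_big_seq (fun x => potential_kernel (x - z) * mu x)); last first.
  by move=> x xs; rewrite hm.
(* The potential of mu takes the same value [C] at [z] and at [y]. *)
rewrite (pot z (ms z Az)).
have pn : pi != 0 :> R by rewrite gt_eqF// pi_gt0.
by move: (pi : R) pn => q qn; field.
Unshelve. all: by end_near. Qed.
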